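(* Let $r\ge 1$, $\mathbf g\simeq \mathbf C_r$ realized in its $2r$-dimensional typical representation with invariant matrix $S$ and group $\mathbf G$ (see context). Let $L_0=i\frac{d}{dx}+q_{(0)}(x,t)-\lambda J$ and $M_0=i\frac{d}{dt}+V(x,t,\lambda)$ be a Lax pair, let $\chi_0^\pm(x,t,\lambda)$ be its fundamental analytic solutions (FAS), and let $\lambda_1^+,\lambda_1^-\in\mathbb C$ with $\operatorname{Im}\lambda_1^+>0$, $\operatorname{Im}\lambda_1^-<0$. Let $n_0,m_0\in\mathbb C^{2r}$ be constant column vectors. Put $$n(x,t)=\chi_0^+(x,t,\lambda_1^+)\,n_0,\qquad m^T(x,t)=m_0^T\,\bigl(\chi_0^-(x,t,\lambda_1^-)\bigr)^{-1},\qquad \rho(x,t)=m^T(x,t)\,n(x,t),$$ $$A(x,t)=-(\lambda_1^--\lambda_1^+)\,m_0^T\bigl(\chi_0^-(x,t,\lambda_1^-)\bigr)^{-1}\dot\chi_0^-(x,t,\lambda_1^-)\,S\,m_0,$$ $$B(x,t)=(\lambda_1^--\lambda_1^+)\,n_0^T\,S\bigl(\chi_0^+(x,t,\lambda_1^+)\bigr)^{-1}\dot\chi_0^+(x,t,\lambda_1^+)\,n_0,$$ where $\dot\chi_0^\pm=\partial\chi_0^\pm/\partial\lambda$. On the open set of $(x,t)$ where $\rho^2+AB\ne 0$ define $$\pi_1=\frac{(\rho n+B\,Sm)\,m^T}{\rho^2+AB},\qquad \pi_{-1}=\frac{S(\rho m+A\,Sn)\,n^TS^{-1}}{\rho^2+AB},$$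 $$q_{(1)}=q_{(0)}+(\lambda_1^--\lambda_1^+)\,[J,\pi_1-\pi_{-1}],$$ $$u(x,t,\lambda)=\mathbf 1+(c_1(\lambda)-1)\,\pi_1(x,t)+(c_1(\lambda)^{-1}-1)\,\pi_{-1}(x,t),\qquad c_1(\lambda)=\frac{\lambda-\lambda_1^+}{\lambda-\lambda_1^-}.$$ Then $u$ is a dressing factor for $L_0$ with dressed Lax potential $q_{(1)}$. That is, for all $\lambda\in\mathbb C\setminus\{\lambda_1^+,\lambda_1^-\}$ and all such $(x,t)$, $u(x,t,\lambda)\in\mathbf G$, i.e. $u^{-1}=S\,u^T\,S^{-1}$, and $$i\frac{\partial u}{\partial x}+q_{(1)}\,u-u\,q_{(0)}-\lambda[J,u]=0 .$$
   Context: All matrices are complex $N\times N$ with $N=2r$; $E_{kn}$ is the matrix unit $(E_{kn})_{ij}=\delta_{ik}\delta_{nj}$; $\bar k=N+1-k$. For $\mathbf C_r$, $$S=\sum_{k=1}^r(-1)^{k+1}(E_{k\bar k}-E_{\bar k k}),\qquad S^{-1}=S^T=-S .$$ The group is $\mathbf G=\{g: g^{-1}=Sg^TS^{-1}\}$ (symplectic), with Lie algebra $\mathbf g=\{X: X+SX^TS^{-1}=0\}$ and Cartan subalgebra $\mathbf h$ of diagonal matrices in $\mathbf g$, spanned by $H_{e_k}=E_{kk}-E_{\bar k\bar k}$. Standing assumptions. $J=\sum_k J_kH_{e_k}\in\mathbf h$ is real, constant and regular: $\alpha(J)>0$ for every positive root $\alpha$ (for $\mathbf C_r$: $J_1>\dots>J_r>0$).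 The potential $q_{(0)}(x,t)$ takes values in $\mathbf g/\mathbf h$, i.e. in the span of the root vectors of $\mathbf g$ (zero Cartan component), is smooth and for each $t$ is a Schwartz-type function of $x$. Moreover $V(x,t,\lambda)=\sum_{k=0}^{P-1}V_k(x,t)\lambda^k-f_P\lambda^PI$ with $V_k\in\mathbf g$, $I\in\mathbf h$ a real constant element, $f_P$ a constant, and $[L_0,M_0]=0$ identically in $\lambda$. Fundamental analytic solutions. For real $\lambda$ let $\phi,\psi$ be the solutions of $L_0\phi=L_0\psi=0$ with $e^{i\lambda Jx}\phi\to\mathbf 1$ as $x\to-\infty$ and $e^{i\lambda Jx}\psi\to\mathbf 1$ as $x\to+\infty$; the scattering matrix is $T=\psi^{-1}\phi$, with Gauss decompositions $T=T^-D^+(S^+)^{-1}=T^+D^-(S^-)^{-1}$, where $S^\pm,T^\pm$ are exponentials of elements in the span of the root vectors $E_{\pm\alpha}$, $\alpha>0$, and $D^\pm$ are in the Cartan subgroup. The FAS of $L_0$ are the $\mathbf G$-valued solutions $\chi_0^\pm$ of $i\partial_x\chi+(q_{(0)}-\lambda J)\chi=0$, analytic in $\lambda$ for $\pm\operatorname{Im}\lambda>0$, with (on the real axis) $e^{i\lambda Jx}\chi_0^\pm\to S^\pm(\lambda)$ as $x\to-\infty$ and $e^{i\lambda Jx}\chi_0^\pm\to T^\mp(\lambda)D^\pm(\lambda)$ as $x\to+\infty$. The FAS of the Lax pair $L_0,M_0$ are these solutions multiplied on the right by $\exp(-if_P\lambda^PIt)$, so that they also satisfy $i\partial_t\chi+V\chi=0$;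 for example, if $q_{(0)}=0$ and $V=-\lambda I$ then $\chi_0^\pm=\exp(-i\lambda(Jx+It))$. *)

(* Defs.v *)
(* Complex numbers are [R[i]] over [R : realType], with the topology of the
   regular module [R[i]^o]. *)
From HB Require Import structures.
From mathcomp Require Import all_boot all_order all_algebra.
From mathcomp Require Import all_classical all_reals all_analysis.
From mathcomp Require Import complex.
Set Implicit Arguments.
Unset Strict Implicit.
Unset Printing Implicit Defensive.
Import Order.TTheory GRing.Theory Num.Theory.
Import numFieldNormedType.Exports.
Local Open Scope classical_set_scope.
Local Open Scope ring_scope.
Local Open Scope complex_scope.

Section Calculus.
Variable R : realType.
Local Notation C := R[i].

(* [R[i]] carries no normed-module structure over [R] in the library, hence
   derivatives in a real variable are taken on real and imaginary parts. *)
Definition derivableR (f : R -> C) (x : R) : Prop :=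
  derivable (fun y => complex.Re (f y)) x 1 /\
  derivable (fun y => complex.Im (f y)) x 1.

Definition deriveR (f : R -> C) (x : R) : C :=
  derive1 (fun y => complex.Re (f y)) x +i* derive1 (fun y => complex.Im (f y)) x.

Definition derivableC (f : C -> C) (z : C) : Prop :=
  derivable (f : C^o -> C^o) z 1.

Definition deriveC (f : C -> C) (z : C) : C := derive1 (f : C -> C^o) z.

Definition derivableR_mx m n (F : R -> 'M[C]_(m, n)) (x : R) : Prop :=
  forall i j, derivableR (fun y => F y i j) x.

Definition deriveR_mx m n (F : R -> 'M[C]_(m, n)) (x : R) : 'M[C]_(m, n) :=
  \matrix_(i, j) deriveR (fun y => F y i j) x.

Definition deriveC_mx m n (F : C -> 'M[C]_(m, n)) (z : C) : 'M[C]_(m, n) :=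
  \matrix_(i, j) deriveC (fun w => F w i j) z.

Definition cvg_mx m n T (F : set_system T) (f : T -> 'M[C]_(m, n))
    (l : 'M[C]_(m, n)) : Prop :=
  forall i j, (f x i j : C^o) @[x --> F] --> (l i j : C^o).

(* A word [w] over {x, t} (true = x, false = t) encodes an iterated partial
   derivative; all of them must exist and be jointly continuous. *)
Definition partial_word (f : R -> R -> C) (w : seq bool) : R -> R -> C :=
  foldr (fun b g => if b then (fun x t => deriveR (g ^~ t) x)
                    else (fun x t => deriveR (g x) t)) f w.

Definition smooth_xt (f : R -> R -> C) : Prop :=
  forall w : seq bool, let g := partial_word f w in
  continuous (fun p : R * R => g p.1 p.2 : C^o) /\
  forall x t, derivableR (g ^~ t) x /\ derivableR (g x) t.

Definition smooth_xt_mx m n (F : R -> R -> 'M[C]_(m, n)) : Prop :=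
  forall i j, smooth_xt (fun x t => F x t i j).

Definition schwartz (f : R -> C) : Prop :=
  forall a b : nat, exists M : R, forall x : R,
  `|(x%:C) ^+ a * iter b deriveR f x| <= M%:C.

Definition iC : C := 0 +i* 1.

Definition cexp (z : C) : C :=
  (expR (complex.Re z))%:C * (cos (complex.Im z) +i* sin (complex.Im z)).

Definition is_expm n (X E : 'M[C]_n) : Prop :=
  cvg_mx \oo (fun K : nat => \sum_(k < K) (k`!%:R^-1 : C) *: (X ^+ k : 'M[C]_n)) E.

Definition comm_mxC n (A B : 'M[C]_n) : 'M[C]_n := A *m B - B *m A.

End Calculus.

(* Matrices have size [r + r]; with 0-based indices the map k |-> N+1-k is
   [rev_ord], and k = 1..r are the indices [lshift r k] for [k : 'I_r]. *)
Section SymplecticC.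
Variables (R : realType) (r : nat).
Local Notation C := R[i].
Local Notation M := 'M[C]_(r + r).
Local Notation idx k := (lshift r k).
Local Notation bar k := (rev_ord (lshift r k)).

(* The sign (-1)^(k+1) becomes (-1)^k after the shift of indices to 0. *)
Definition Smx : M :=
  \sum_(k < r) (-1) ^+ k *: (delta_mx (idx k) (bar k) - delta_mx (bar k) (idx k)).

Definition in_G (g : M) : Prop :=
  g \in unitmx /\ invmx g = Smx *m g^T *m invmx Smx.

Definition in_g (X : M) : Prop := X + Smx *m X^T *m invmx Smx = 0.

Definition H_e (k : 'I_r) : M :=
  delta_mx (idx k) (idx k) - delta_mx (bar k) (bar k).

Definition cartan (h : 'I_r -> C) : M := \sum_(k < r) h k *: H_e k.

Definition cartan_exp (h : 'I_r -> C) : M :=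
  \matrix_(i, j) (cexp (cartan h i i) *+ (i == j)).

Definition cartan_subgroup (g : M) : Prop := in_G g /\ is_diag_mx g.

(* A root is the row vector of its integer coordinates on e_1, ..., e_r, where
   e_k is the functional reading off the coefficient of H_{e_k}. *)
Definition eps (k : 'I_r) : 'rV[int]_r := delta_mx 0 k.

Definition pos_root (al : 'rV[int]_r) : Prop :=
  (exists k j : 'I_r, (k < j)%N /\ (al = eps k - eps j \/ al = eps k + eps j))
  \/ (exists k : 'I_r, al = eps k *+ 2).

Definition neg_root (al : 'rV[int]_r) : Prop := pos_root (- al).

Definition is_root (al : 'rV[int]_r) : Prop := pos_root al \/ neg_root al.

Definition root_val (K : pzRingType) (al : 'rV[int]_r) (h : 'I_r -> K) : K :=
  \sum_(k < r) (al 0 k)%:~R * h k.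

Definition root_vector (al : 'rV[int]_r) (X : M) : Prop :=
  in_g X /\
  forall h : 'I_r -> C, comm_mxC (cartan h) X = root_val al h *: X.

(* Root spaces are stable under scaling, so finite sums give the whole span. *)
Definition root_span (Phi : 'rV[int]_r -> Prop) (X : M) : Prop :=
  exists (n : nat) (al : 'I_n -> 'rV[int]_r) (Y : 'I_n -> M),
  (forall i, Phi (al i) /\ root_vector (al i) (Y i)) /\ X = \sum_(i < n) Y i.

Definition exp_root_span (Phi : 'rV[int]_r -> Prop) (g : M) : Prop :=
  exists X : M, root_span Phi X /\ is_expm X g.

End SymplecticC.

Section LaxPair.
Variables (R : realType) (r : nat).
Local Notation C := R[i].
Local Notation M := 'M[C]_(r + r).
Local Notation V := 'cV[C]_(r + r).

Definition real_cartan (J : 'I_r -> R) : M := cartan (fun k => (J k)%:C).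

Definition L_op (q : R -> R -> M) (J : M) (l : C) (f : R -> R -> V) : R -> R -> V :=
  fun x t => iC R *: deriveR_mx (f ^~ t) x + (q x t - l *: J) *m f x t.

Definition M_op (W : R -> R -> C -> M) (l : C) (f : R -> R -> V) : R -> R -> V :=
  fun x t => iC R *: deriveR_mx (f x) t + W x t l *m f x t.

Definition lax_V (P : nat) (Vk : 'I_P -> R -> R -> M) (fP : C) (I : 'I_r -> R) :
    R -> R -> C -> M :=
  fun x t l =>
    \sum_(k < P) l ^+ k *: Vk k x t - (fP * l ^+ P) *: real_cartan I.

Definition lax_commute (q : R -> R -> M) (J : M) (W : R -> R -> C -> M) : Prop :=
  forall (l : C) (f : R -> R -> V), smooth_xt_mx f ->
  forall x t,
  L_op q J l (M_op W l f) x t - M_op W l (L_op q J l f) x t = 0.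

(* Differentiability of the V_k in x is what makes the commutator meaningful
   with the total derivative [deriveR_mx]. *)
Definition lax_pair (q : R -> R -> M) (J I : 'I_r -> R) (P : nat)
    (Vk : 'I_P -> R -> R -> M) (fP : C) : Prop :=
  [/\ (forall al, pos_root al -> 0 < root_val al J),
      (forall x t, root_span (@is_root r) (q x t)),
      smooth_xt_mx q /\ (forall t i j, schwartz (fun x => q x t i j)),
      (forall k x t, in_g (Vk k x t) /\ derivableR_mx (Vk k ^~ t) x) &
      lax_commute q (real_cartan J) (lax_V Vk fP I)].

Definition x_solution (q : R -> M) (J : M) (l : C) (F : R -> M) : Prop :=
  forall x, derivableR_mx F x /\
    iC R *: deriveR_mx F x + (q x - l *: J) *m F x = 0.

(* e^{i l J x} F(x) tends to E along the filter [Fx]; here l is real. *)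
Definition asymptotic (J : 'I_r -> R) (l : R) (Fx : set_system R) (F : R -> M)
    (E : M) : Prop :=
  cvg_mx Fx
    (fun x => cartan_exp (fun k => iC R * (l * J k * x)%:C) *m F x) E.

Definition upper_half : set C := [set l | 0 < complex.Im l].
Definition lower_half : set C := [set l | complex.Im l < 0].
Definition real_axis : set C := [set l | complex.Im l = 0].

(* One of the two FAS, at fixed t: [D] is the open half-plane of analyticity,
   [El], [Er] the asymptotic values on the real axis.  Continuity up to the
   real axis is what ties the boundary values to the analytic function. *)
Definition half_FAS (q : R -> M) (J : 'I_r -> R) (D : set C)
    (El Er : R -> M) (chi : R -> C -> M) : Prop :=
  [/\ (forall x l, (D `|` real_axis) l -> in_G (chi x l)),
      (forall l, (D `|` real_axis) l ->
         x_solution q (real_cartan J) l (chi ^~ l)),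
      (forall x i j l, D l -> derivableC (fun z => chi x z i j) l),
      (forall x i j, {within (D `|` real_axis : set C^o),
         continuous (fun z : C^o => chi x z i j : C^o)}) &
      (forall l : R,
         asymptotic J l (-oo)%R (chi ^~ l%:C) (El l) /\
         asymptotic J l (+oo)%R (chi ^~ l%:C) (Er l))].

Definition FAS_L (q : R -> M) (J : 'I_r -> R) (chip chim : R -> C -> M) : Prop :=
  exists (phi psi : R -> R -> M) (T Sp Sm Tp Tm Dp Dm : R -> M),
  [/\ (forall l : R,
         x_solution q (real_cartan J) l%:C (phi ^~ l) /\
         asymptotic J l (-oo)%R (phi ^~ l) 1%:M),
      (forall l : R,
         x_solution q (real_cartan J) l%:C (psi ^~ l) /\
         asymptotic J l (+oo)%R (psi ^~ l) 1%:M),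
      (forall x l, T l = invmx (psi x l) *m phi x l),
      (forall l,
         [/\ T l = Tm l *m Dp l *m invmx (Sp l) /\
             T l = Tp l *m Dm l *m invmx (Sm l),
             exp_root_span (@pos_root r) (Sp l) /\
             exp_root_span (@neg_root r) (Sm l),
             exp_root_span (@pos_root r) (Tp l) /\
             exp_root_span (@neg_root r) (Tm l) &
             cartan_subgroup (Dp l) /\ cartan_subgroup (Dm l)]) &
      half_FAS q J upper_half Sp (fun l => Tm l *m Dp l) chip /\
      half_FAS q J lower_half Sm (fun l => Tp l *m Dm l) chim].

Definition t_exp (P : nat) (fP : C) (I : 'I_r -> R) (t : R) (l : C) : M :=
  cartan_exp (fun k => - iC R * fP * l ^+ P * (I k * t)%:C).

(* The FAS of the pair: FAS of L at each time, multiplied on the right by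
   exp(-i f_P l^P I t), and solving both linear problems. *)
Definition FAS_pair (q : R -> R -> M) (J I : 'I_r -> R) (P : nat)
    (Vk : 'I_P -> R -> R -> M) (fP : C) (chip chim : R -> R -> C -> M) : Prop :=
  let W := lax_V Vk fP I in
  let t_solution (D : set C) (chi : R -> R -> C -> M) :=
    forall x t l, (D `|` real_axis) l ->
      derivableR_mx (fun s => chi x s l) t /\
      iC R *: deriveR_mx (fun s => chi x s l) t + W x t l *m chi x t l = 0 in
  exists etap etam : R -> R -> C -> M,
  [/\ (forall t, FAS_L (q ^~ t) J (fun x l => etap x t l) (fun x l => etam x t l)),
      (forall x t l, (upper_half `|` real_axis) l ->
         chip x t l = etap x t l *m t_exp P fP I t l),
      (forall x t l, (lower_half `|` real_axis) l ->
         chim x t l = etam x t l *m t_exp P fP I t l),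
      t_solution upper_half chip &
      t_solution lower_half chim].

(* u intertwines L (potential q0) with the operator of potential q1 at the
   point (x,t) and takes its value in G there. *)
Definition dressing_at (J : M) (q0 q1 : R -> R -> M) (u : R -> R -> C -> M)
    (x t : R) (l : C) : Prop :=
  [/\ in_G (u x t l),
      derivableR_mx (fun y => u y t l) x &
      iC R *: deriveR_mx (fun y => u y t l) x + q1 x t *m u x t l
        - u x t l *m q0 x t - l *: comm_mxC J (u x t l) = 0].

End LaxPair.

(* Main.v *)
Require Import Defs.
From HB Require Import structures.
From mathcomp Require Import all_boot all_order all_algebra.
From mathcomp Require Import all_classical all_reals all_analysis.
From mathcomp Require Import complex ring lra zify.
Set Implicit Arguments.
Unset Strict Implicit.
Unset Printing Implicit Defensive.
Import Order.TTheory GRing.Theory Num.Theory.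
Import numFieldNormedType.Exports.
Local Open Scope ring_scope.
Local Open Scope complex_scope.

(* Put k = S m and p = n^T S^-1.  Then n and k solve L_0 at lambda_1^+ and
   lambda_1^-, m^T and p solve the dual equations, m^T k = p n = 0 and
   m^T n = p k = rho.  Writing X = (n, k), Y = (m^T; p) and
   W = ((rho, A), (-B, rho))^-1, one has u = 1 + X W diag(c_1 - 1, 1/c_1 - 1) Y
   with Y X = rho.  Membership in G and the dressing equation become 2 x 2
   identities once i rho_x, i A_x, i B_x are known to be -(lambda_1^- -
   lambda_1^+) times m^T J n, m^T J k, p J n.  For A and B this is
   i (chi^-1 chi_lambda)_x = chi^-1 J chi, which requires exchanging the
   derivatives in x and lambda although chi is only separately regular. *)

(** * The algebra of the dressing factor *)

(** The exchange rests on v(y, l) = chi(y, z)^-1 chi(y, l) w. It equals w at l = z for every y, its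
    l-derivative there is the logarithmic derivative applied to w, and the potential cancels between
    the two linear equations: i v_y = (l - z) chi(y, z)^-1 J chi(y, z) v. The factor l - z, with a
    Gronwall-type bound, keeps v(y, l) - w small uniformly in y near x0, starting from information
    at the single point x0. For a fixed increment t in x the increment h in l can therefore be
    chosen afterwards, depending on t, and only the difference quotients at x0 and x0 + t have to be
    compared. On the algebraic side c_1 - 1 = (lm - lp)/(l - lm) and 1/c_1 - 1 = - (lm - lp)/(l -
    lp). Hence u = 1 + (lm - lp)(pi_1 - pi_{-1})/l + O(l^-2), and the part of order l^0 of the
    dressing equation dictates the correction term of q_{(1)}. *)

Lemma mxE_rank1 (F : pzSemiRingType) m n (v : 'cV[F]_m) (w : 'rV[F]_n) i j :
  (v *m w) i j = v i 0 * w 0 j.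
Proof. by rewrite mxE big_ord1. Qed.

(** [I] stands for the imaginary unit and the [d]-variables for x-derivatives, so that analysis
    enters only through the relations imposed on them. Since u and P have the forms 1 + n r1 + k r2
    and n s1 + k s2, every product contracts to rho or to a value of the bilinear form of J, and (l
    - lm) a = om, (l - lp) b = - om absorb the explicit l. *)
Lemma dressing_equation (F : fieldType) N (q J : 'M[F]_N) (n k dn dk : 'cV[F]_N)
    (m p dm dp : 'rV[F]_N) (I lp lm l rho A B drho dA dB : F) :
  let D := rho ^+ 2 + A * B in
  let om := lm - lp in
  let a := (l - lp) / (l - lm) - 1 in
  let b := ((l - lp) / (l - lm))^-1 - 1 in
  let pi1 := D^-1 *: ((rho *: n + B *: k) *m m) in
  let pim1 := D^-1 *: ((rho *: k - A *: n) *m p) in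
  let dDV := - (D ^- 2 * (2 * rho * drho + (dA * B + A * dB))) in
  let dpi1 := dDV *: ((rho *: n + B *: k) *m m)
    + D^-1 *: ((drho *: n + rho *: dn + (dB *: k + B *: dk)) *m m
               + (rho *: n + B *: k) *m dm) in
  let dpim1 := dDV *: ((rho *: k - A *: n) *m p)
    + D^-1 *: ((drho *: k + rho *: dk - (dA *: n + A *: dn)) *m p
               + (rho *: k - A *: n) *m dp) in
  let u := 1%:M + a *: pi1 + b *: pim1 in
  let du := a *: dpi1 + b *: dpim1 in
  let P := pi1 - pim1 in
  I != 0 -> l != lp -> l != lm -> D != 0 ->
  m *m k = 0 -> p *m n = 0 -> m *m n = rho%:M -> p *m k = rho%:M ->
  I *: dn = - ((q - lp *: J) *m n) -> I *: dk = - ((q - lm *: J) *m k) ->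
  I *: dm = m *m (q - lm *: J) -> I *: dp = p *m (q - lp *: J) ->
  I * drho = - om * (m *m J *m n) 0 0 ->
  I * dA = - om * (m *m J *m k) 0 0 ->
  I * dB = - om * (p *m J *m n) 0 0 ->
  p *m J *m k = - (m *m J *m n) ->
  I *: du + (q + om *: (J *m P - P *m J)) *m u - u *m q
    - l *: (J *m u - u *m J) = 0.
Proof.
move=> D om a b pi1 pim1 dDV dpi1 dpim1 u du P I0 llp llm D0 mk pn mn pk.
move=> hn hk hm hp hrho hA hB pJk.
(* Existentials rather than local definitions: the row vectors stay opaque, and matrix products can
   be contracted before they are expanded. *)
have [r1 r1E] : exists v, v = (D^-1 * a * rho) *: m - (D^-1 * b * A) *: p by eexists.
have [r2 r2E] : exists v, v = (D^-1 * a * B) *: m + (D^-1 * b * rho) *: p by eexists.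
have [s1 s1E] : exists v, v = (D^-1 * rho) *: m + (D^-1 * A) *: p by eexists.
have [s2 s2E] : exists v, v = (D^-1 * B) *: m - (D^-1 * rho) *: p by eexists.
have uE : u = 1%:M + (n *m r1 + k *m r2).
  apply/matrixP => i j; rewrite /u /pi1 /pim1 r1E r2E.
  by rewrite !(mxE_rank1, mxE); ring.
have PE : P = n *m s1 + k *m s2.
  apply/matrixP => i j; rewrite /P /pi1 /pim1 s1E s2E.
  by rewrite !(mxE_rank1, mxE); ring.
(* Three scalars suffice: the fourth pairing p J k is - al by hypothesis. *)
have [al alE] : exists al, m *m J *m n = al%:M.
  by exists ((m *m J *m n) 0 0); exact: mx11_scalar.
have [be beE] : exists be, m *m J *m k = be%:M.
  by exists ((m *m J *m k) 0 0); exact: mx11_scalar.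
have [ga gaE] : exists ga, p *m J *m n = ga%:M.
  by exists ((p *m J *m n) 0 0); exact: mx11_scalar.
have sN (c : F) : - c%:M = (- c)%:M :> 'M[F]_1 by rewrite raddfN.
have sD (c d : F) : c%:M + d%:M = (c + d)%:M :> 'M[F]_1 by rewrite raddfD.
have sB (c d : F) : c%:M - d%:M = (c - d)%:M :> 'M[F]_1 by rewrite raddfB.
have dl : l - lm != 0 by rewrite subr_eq0.
have dl' : l - lp != 0 by rewrite subr_eq0.
rewrite uE.
have -> : J *m P - P *m J = J *m n *m s1 + J *m k *m s2 - (n *m (s1 *m J) + k *m (s2 *m J)).
  by rewrite PE mulmxDr mulmxDl !mulmxA.
set K := (J *m n *m s1 + J *m k *m s2 - (n *m (s1 *m J) + k *m (s2 *m J))).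
have s1n : s1 *m n = (D^-1 * rho ^+ 2)%:M.
  by rewrite s1E mulmxDl -!scalemxAl mn pn scaler0 addr0 scale_scalar_mx; congr (_ %:M); ring.
have s1k : s1 *m k = (D^-1 * A * rho)%:M.
  by rewrite s1E mulmxDl -!scalemxAl mk pk scaler0 add0r scale_scalar_mx.
have s2n : s2 *m n = (D^-1 * B * rho)%:M.
  by rewrite s2E mulmxBl -!scalemxAl mn pn scaler0 subr0 scale_scalar_mx.
have s2k : s2 *m k = (- (D^-1 * rho ^+ 2))%:M.
  by rewrite s2E mulmxBl -!scalemxAl mk pk scaler0 sub0r scale_scalar_mx sN;
    congr (_ %:M); ring.
have s1Jn : s1 *m J *m n = (D^-1 * (rho * al + A * ga))%:M.
  by rewrite s1E !mulmxDl -!scalemxAl alE gaE !scale_scalar_mx sD; congr (_ %:M); ring.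
have s1Jk : s1 *m J *m k = (D^-1 * (rho * be - A * al))%:M.
  rewrite s1E !mulmxDl -!scalemxAl pJk beE alE sN !scale_scalar_mx sD; congr (_ %:M); ring.
have s2Jn : s2 *m J *m n = (D^-1 * (B * al - rho * ga))%:M.
  rewrite s2E !mulmxBl -!scalemxAl alE gaE !scale_scalar_mx sB; congr (_ %:M); ring.
have s2Jk : s2 *m J *m k = (D^-1 * (B * be + rho * al))%:M.
  rewrite s2E !mulmxBl -!scalemxAl pJk beE alE sN !scale_scalar_mx sB; congr (_ %:M); ring.
have Kn : K *m n = (D^-1 * rho ^+ 2) *: (J *m n) + (D^-1 * B * rho) *: (J *m k)
   - (D^-1 * (rho * al + A * ga)) *: n - (D^-1 * (B * al - rho * ga)) *: k.
  rewrite /K mulmxBl !mulmxDl -!mulmxA s1n s2n !(mulmxA s1) !(mulmxA s2) s1Jn s2Jn.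
  by rewrite !mulmxA !mul_mx_scalar opprD addrA.
have Kk : K *m k = (D^-1 * A * rho) *: (J *m n) - (D^-1 * rho ^+ 2) *: (J *m k)
   - (D^-1 * (rho * be - A * al)) *: n - (D^-1 * (B * be + rho * al)) *: k.
  rewrite /K mulmxBl !mulmxDl -!mulmxA s1k s2k !(mulmxA s1) !(mulmxA s2) s1Jk s2Jk.
  by rewrite !mulmxA !mul_mx_scalar opprD addrA scaleNr.
have qE : (q + om *: K) *m (1%:M + (n *m r1 + k *m r2)) =
  q + (q *m n) *m r1 + (q *m k) *m r2 + om *: (K + (K *m n) *m r1 + (K *m k) *m r2).
  by rewrite mulmxDl !mulmxDr !mulmx1 -!scalemxAl !mulmxA !scalerDr !addrA.
have uqE Q : (1%:M + (n *m r1 + k *m r2)) *m Q = Q + n *m (r1 *m Q) + k *m (r2 *m Q).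
  by rewrite !mulmxDl mul1mx !mulmxA addrA.
have JuE : J *m (1%:M + (n *m r1 + k *m r2)) = J + (J *m n) *m r1 + (J *m k) *m r2.
  by rewrite !mulmxDr mulmx1 !mulmxA addrA.
rewrite qE !uqE JuE Kn Kk /K.
move: hrho hA hB; rewrite alE beE gaE !mxE eqxx !mulr1n => hrho hA hB.
have r1Q Q : r1 *m Q = (D^-1 * a * rho) *: (m *m Q) - (D^-1 * b * A) *: (p *m Q).
  by rewrite r1E mulmxBl -!scalemxAl.
have r2Q Q : r2 *m Q = (D^-1 * a * B) *: (m *m Q) + (D^-1 * b * rho) *: (p *m Q).
  by rewrite r2E mulmxDl -!scalemxAl.
have s1Q Q : s1 *m Q = (D^-1 * rho) *: (m *m Q) + (D^-1 * A) *: (p *m Q).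
  by rewrite s1E mulmxDl -!scalemxAl.
have s2Q Q : s2 *m Q = (D^-1 * B) *: (m *m Q) - (D^-1 * rho) *: (p *m Q).
  by rewrite s2E mulmxBl -!scalemxAl.
rewrite !r1Q !r2Q !s1Q !s2Q.
move: hn hk hm hp; rewrite !mulmxBl !mulmxBr -!scalemxAl -!scalemxAr.
(* The images under q and J become independent variables. Once the derivatives are solved for, what
   remains is a rational identity in each entry. *)
move: (q *m n) (q *m k) (J *m n) (J *m k) (m *m q) (m *m J) (p *m q) (p *m J).
move=> qn qk Jn Jk mq mJ pq pJ hn hk hm hp.
have divE (x y : F) : I * x = y -> x = y / I by move=> <-; field.
have {}hn i : dn i 0 = (- (qn i 0 - lp * Jn i 0)) / I.
  by apply: divE; move/matrixP/(_ i 0): hn; rewrite !mxE.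
have {}hk i : dk i 0 = (- (qk i 0 - lm * Jk i 0)) / I.
  by apply: divE; move/matrixP/(_ i 0): hk; rewrite !mxE.
have {}hm i : dm 0 i = (mq 0 i - lm * mJ 0 i) / I.
  by apply: divE; move/matrixP/(_ 0 i): hm; rewrite !mxE.
have {}hp i : dp 0 i = (pq 0 i - lp * pJ 0 i) / I.
  by apply: divE; move/matrixP/(_ 0 i): hp; rewrite !mxE.
move/divE: hrho => hrho; move/divE: hA => hA; move/divE: hB => hB.
apply/matrixP => i j.
rewrite /du /dpi1 /dpim1 r1E r2E s1E s2E.
rewrite !(mxE_rank1, mxE).
rewrite !hn !hk !hm !hp.
rewrite /dDV hrho hA hB.
move: (J i j) (q i j) (n i 0) (k i 0) (m 0 j) (p 0 j) (qn i 0) (qk i 0) (Jn i 0) (Jk i 0)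
 (mq 0 j) (mJ 0 j) (pq 0 j) (pJ 0 j).
rewrite /a /b /om; move: D0; rewrite /D.
clear -I0 dl dl'.
move=> D0 *; field.
by rewrite I0 dl dl' D0.
Qed.

(** The symplectic adjoint g -> S g^T S^-1 turns the columns n, k into the rows p, - m, so the
    adjoint of u again differs from 1 by columns in the span of n and k. The product reduces to 2 x
    2 contractions, which cancel because c c^-1 = 1 and D = rho^2 + A B. *)
Lemma mul_dressing_factor (F : fieldType) N (S : 'M[F]_N) (n : 'cV[F]_N)
    (m : 'rV[F]_N) (rho A B c : F) :
  let D := rho ^+ 2 + A * B in
  let k := S *m m^T in
  let p := n^T *m (- S) in
  let pi1 := D^-1 *: ((rho *: n + B *: k) *m m) in
  let pim1 := D^-1 *: ((rho *: k - A *: n) *m p) in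
  let u := 1%:M + (c - 1) *: pi1 + (c^-1 - 1) *: pim1 in
  S^T = - S -> S *m S = - 1%:M -> c != 0 -> D != 0 ->
  m *m k = 0 -> p *m n = 0 -> m *m n = rho%:M -> p *m k = rho%:M ->
  u *m (S *m u^T *m (- S)) = 1%:M.
Proof.
move=> D k p pi1 pim1 u ST SS c0 D0 mk pn mn pk.
set a := c - 1; set b := c^-1 - 1.
have [r1 r1E] : exists v, v = (D^-1 * a * rho) *: m - (D^-1 * b * A) *: p by eexists.
have [r2 r2E] : exists v, v = (D^-1 * a * B) *: m + (D^-1 * b * rho) *: p by eexists.
have uE : u = 1%:M + (n *m r1 + k *m r2).
  rewrite /u /pi1 /pim1 r1E r2E -/a -/b.
  move: (k) (p) => k' p'; apply/matrixP => i j.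
  by rewrite !(mxE_rank1, mxE); ring.
have SNT : (- S)^T = S by rewrite -ST trmxK.
have SmT : S *m m^T = k by [].
have SpT : S *m p^T = - n.
  by rewrite /p trmx_mul SNT trmxK mulmxA SS mulNmx mul1mx.
have kT : k^T *m (- S) = - m.
  by rewrite /k trmx_mul trmxK ST !mulmxN mulNmx opprK -mulmxA SS mulmxN mulmx1.
have r1S : S *m r1^T = (D^-1 * a * rho) *: k + (D^-1 * b * A) *: n.
  have -> : r1^T = (D^-1 * a * rho) *: m^T - (D^-1 * b * A) *: p^T.
    by apply/matrixP => i j; rewrite r1E !mxE.
  by rewrite mulmxBr -!scalemxAr SmT SpT scalerN opprK.
have r2S : S *m r2^T = (D^-1 * a * B) *: k - (D^-1 * b * rho) *: n.
  have -> : r2^T = (D^-1 * a * B) *: m^T + (D^-1 * b * rho) *: p^T.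
    by apply/matrixP => i j; rewrite r2E !mxE.
  by rewrite mulmxDr -!scalemxAr SmT SpT scalerN.
have -> : S *m u^T *m (- S) = 1%:M + (S *m r1^T *m p - S *m r2^T *m m).
  rewrite uE !linearD /= trmx1 (trmx_mul n) (trmx_mul k).
  rewrite !(mulmxDr, mulmxDl) mulmx1 mulmxN SS opprK.
  congr (_ + (_ + _)); first by rewrite /p !mulmxA.
  by rewrite (mulmxA S) -(mulmxA (S *m r2^T)) kT mulmxN.
rewrite r1S r2S uE.
have r1n : r1 *m n = (D^-1 * a * rho ^+ 2)%:M.
  by rewrite r1E mulmxBl -!scalemxAl mn pn scaler0 subr0 scale_scalar_mx; congr (_ %:M); ring.
have r1k : r1 *m k = (- (D^-1 * b * A * rho))%:M.
  by rewrite r1E mulmxBl -!scalemxAl mk pk scaler0 sub0r scale_scalar_mx raddfN.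
have r2n : r2 *m n = (D^-1 * a * B * rho)%:M.
  by rewrite r2E mulmxDl -!scalemxAl mn pn scaler0 addr0 scale_scalar_mx.
have r2k : r2 *m k = (D^-1 * b * rho ^+ 2)%:M.
  by rewrite r2E mulmxDl -!scalemxAl mk pk scaler0 add0r scale_scalar_mx; congr (_ %:M); ring.
clearbody k p.
have mulE (v w : 'cV[F]_N) (f g : 'rV[F]_N) s : f *m v = s%:M ->
    w *m f *m (v *m g) = s *: (w *m g).
  by move=> E; rewrite mulmxA -(mulmxA w) E mul_mx_scalar scalemxAl.
rewrite !(mulmxDl, mulmxDr, mulmxN, mulNmx, mul1mx, mulmx1) -!scalemxAl ?mulmxN.
rewrite -!scalemxAr.
rewrite !(mulE _ _ _ _ _ r1n) !(mulE _ _ _ _ _ r1k).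
rewrite !(mulE _ _ _ _ _ r2n) !(mulE _ _ _ _ _ r2k).
rewrite r1E r2E; apply/matrixP => i j; rewrite !(mxE_rank1, mxE).
rewrite /a /b; move: (n i 0) (k i 0) (m 0 j) (p 0 j) => ni ki mj pj.
move: D0; rewrite /D => D0; field.
by rewrite c0 D0.
Qed.

(** * The symplectic form and the group G *)

Lemma bar_lshift_neq r (k l : 'I_r) : (rev_ord (lshift r k) == lshift r l) = false.
Proof. by apply/eqP => /(congr1 val) /=; have := ltn_ord k; have := ltn_ord l; lia. Qed.

Lemma lshift_bar_neq r (k l : 'I_r) : (lshift r k == rev_ord (lshift r l)) = false.
Proof. by rewrite eq_sym bar_lshift_neq. Qed.

(** The lower index [rshift r k] is the mirror image of the upper index with number [rev_ord k];
    this gives the exponent, and the term - E_{bar k, k} of S gives the minus sign. *)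
Definition Ssgn (R : realType) r (i : 'I_(r + r)) : R[i] :=
  match fintype.split i with inl k => (-1) ^+ k | inr k => - (-1) ^+ rev_ord k end.

Lemma SmxE (R : realType) r (i j : 'I_(r + r)) :
  @Smx R r i j = Ssgn R i *+ (j == rev_ord i).
Proof.
rewrite /Smx summxE /Ssgn.
case: (split_ordP i) => k ->.
  rewrite (bigD1 k) //= big1 ?addr0 => [|l lk]; rewrite !mxE.
    by rewrite eqxx lshift_bar_neq /= subr0 mulr_natr.
  by rewrite (inj_eq (@lshift_inj _ _)) eq_sym (negPf lk) lshift_bar_neq subrr mulr0.
have E : rshift r k = rev_ord (lshift r (rev_ord k)).
  by apply: val_inj => /=; have := ltn_ord k; lia.
rewrite E rev_ordK (bigD1 (rev_ord k)) //= big1 ?addr0 => [|l lk]; rewrite !mxE.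
  by rewrite eqxx bar_lshift_neq /= sub0r mulrN mulr_natr mulNrn.
rewrite bar_lshift_neq (inj_eq rev_ord_inj) (inj_eq (@lshift_inj _ _)).
by rewrite [rev_ord k == l]eq_sym (negPf lk) subrr mulr0.
Qed.

Lemma Smx_tr (R : realType) r : (@Smx R r)^T = - @Smx R r.
Proof.
rewrite /Smx linear_sum -sumrN /=; apply: eq_bigr => k _.
by rewrite linearZ /= linearB /= !trmx_delta -scalerN opprB.
Qed.

Lemma Smx_sqr (R : realType) r : @Smx R r *m @Smx R r = - 1%:M.
Proof.
apply/matrixP => i j; rewrite !mxE (bigD1 (rev_ord i)) //= big1 => [|l li].
  rewrite addr0 !SmxE eqxx rev_ordK mulr1n mulrnAr (eq_sym j) -mulNrn; congr (_ *+ _).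
  (* The indices i and [rev_ord i] lie in opposite halves, so two of the four cases are
     contradictory; in the other two the signs are opposite. *)
  rewrite /Ssgn; case: (split_ordP i) => k ->; case: split_ordP => l /(congr1 val) /= E.
  - by have := ltn_ord k; have := ltn_ord l; lia.
  - rewrite mulrN -exprD addnC; have -> : (r - l.+1 = k)%N.
      by have := ltn_ord k; have := ltn_ord l; lia.
    by rewrite addnn -mul2n exprM sqrrN !expr1n.
  - rewrite mulNr -exprD; have -> : (r - k.+1 = l)%N.
      by have := ltn_ord k; have := ltn_ord l; lia.
    by rewrite addnn -mul2n exprM sqrrN !expr1n.
  - by have := ltn_ord k; have := ltn_ord l; lia.
by rewrite SmxE (negPf li) mul0r.
Qed.

Lemma Smx_unit (R : realType) r : @Smx R r \in unitmx.
Proof.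
have : @Smx R r *m (- @Smx R r) = 1%:M by rewrite mulmxN Smx_sqr opprK.
by case/mulmx1_unit.
Qed.

Lemma Smx_inv (R : realType) r : invmx (@Smx R r) = - @Smx R r.
Proof.
apply: (can_inj (mulKmx (@Smx_unit R r))).
by rewrite mulmxV ?Smx_unit // mulmxN Smx_sqr opprK.
Qed.

Lemma in_gP (R : realType) r (X : 'M[R[i]]_(r + r)) :
  in_g X -> @Smx R r *m X^T *m (- @Smx R r) = - X.
Proof. by rewrite /in_g Smx_inv => /eqP; rewrite addrC addr_eq0 => /eqP. Qed.

Lemma in_g_tr (R : realType) r (X : 'M[R[i]]_(r + r)) :
  in_g X -> @Smx R r *m X^T = - X *m @Smx R r.
Proof.
move=> /in_gP E; rewrite -E -mulmxA mulNmx Smx_sqr opprK mulmx1 //.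
Qed.

Lemma in_GP (R : realType) r (g : 'M[R[i]]_(r + r)) :
  in_G g <-> g *m (@Smx R r *m g^T *m (- @Smx R r)) = 1%:M.
Proof.
split; first by case=> gu; rewrite -Smx_inv => <-; rewrite mulmxV.
move=> E; have gu : g \in unitmx by case: (mulmx1_unit E).
split=> //; apply: (can_inj (mulKmx gu)).
by rewrite mulmxV // Smx_inv E.
Qed.

(** Invariance of the form, free of inverses; closure under products is immediate from it. *)
Lemma in_GS (R : realType) r (g : 'M[R[i]]_(r + r)) :
  in_G g <-> g *m @Smx R r *m g^T = @Smx R r.
Proof.
rewrite in_GP !mulmxA; split=> [E|->]; last by rewrite mulmxN Smx_sqr opprK.
have := congr1 (mulmx^~ (@Smx R r)) E.
by rewrite -mulmxA mulNmx Smx_sqr opprK mulmx1 mul1mx.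
Qed.

Lemma in_G_mul (R : realType) r (g h : 'M[R[i]]_(r + r)) :
  in_G g -> in_G h -> in_G (g *m h).
Proof.
rewrite !in_GS => Eg Eh; rewrite trmx_mul -{2}Eg -{2}Eh !mulmxA //.
Qed.

Lemma H_eE (R : realType) r (k : 'I_r) i j :
 @H_e R r k i j = ((i == lshift r k)%:R - (i == rev_ord (lshift r k))%:R) *+ (i == j).
Proof.
rewrite !mxE; have [->|] := eqVneq i j; first by rewrite !andbb.
case: (eqVneq i (lshift r k)) => [->|_] /=.
  by rewrite lshift_bar_neq [j == _]eq_sym => /negPf ->; rewrite subr0.
case: (eqVneq i (rev_ord _)) => [->|_] /=; rewrite ?subrr ?sub0r //.
by rewrite [j == _]eq_sym => /negPf ->; rewrite oppr0.
Qed.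

Lemma cartanE (R : realType) r (h : 'I_r -> R[i]) i j :
  cartan h i j = cartan h i i *+ (i == j).
Proof.
rewrite /cartan !summxE -sumrMnl; apply: eq_bigr => k _.
by rewrite [LHS]mxE [X in X *+ _]mxE !H_eE eqxx mulr1n mulrnAr.
Qed.

Lemma cartan_bar (R : realType) r (h : 'I_r -> R[i]) i :
  cartan h (rev_ord i) (rev_ord i) = - cartan h i i.
Proof.
rewrite /cartan !summxE -sumrN; apply: eq_bigr => k _.
rewrite [LHS]mxE [X in _ = - X]mxE !H_eE !eqxx !mulr1n -mulrN opprB.
by rewrite (inj_eq rev_ord_inj) -(inj_eq rev_ord_inj) rev_ordK.
Qed.

Lemma cartan_in_g (R : realType) r (h : 'I_r -> R[i]) : in_g (cartan h).
Proof.
rewrite /in_g Smx_inv mulmxN.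
have -> : @Smx R r *m (cartan h)^T = - cartan h *m @Smx R r.
  apply/matrixP => i j; rewrite mulNmx !mxE (bigD1 j) //= [in RHS](bigD1 i) //= !big1.
  - rewrite !addr0 mxE SmxE; have [->|] := eqVneq j (rev_ord i); last first.
      by rewrite mul0r mulr0 oppr0.
    by rewrite mulr1n cartan_bar mulrN mulrC.
  - by move=> l li; rewrite cartanE eq_sym (negPf li) mul0r.
  - by move=> l lj; rewrite mxE cartanE eq_sym (negPf lj) mulr0.
by rewrite -mulmxA Smx_sqr mulmxN mulmx1 opprK subrr.
Qed.

Lemma root_span_in_g (R : realType) r Phi (X : 'M[R[i]]_(r + r)) :
  root_span Phi X -> in_g X.
Proof.
move=> [n [al [Y [HY ->]]]]; rewrite /in_g linear_sum mulmx_sumr mulmx_suml -big_split /=.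
by apply: big1 => i _; case: (HY i) => _ [].
Qed.

(** * Derivatives of complex functions of a real variable *)

Lemma cReD (R : realType) (z w : R[i]) : complex.Re (z + w) = complex.Re z + complex.Re w.
Proof. by case: z; case: w. Qed.

Lemma cImD (R : realType) (z w : R[i]) : complex.Im (z + w) = complex.Im z + complex.Im w.
Proof. by case: z; case: w. Qed.

Lemma cReN (R : realType) (z : R[i]) : complex.Re (- z) = - complex.Re z.
Proof. by case: z. Qed.

Lemma cImN (R : realType) (z : R[i]) : complex.Im (- z) = - complex.Im z.
Proof. by case: z. Qed.

Lemma cReM (R : realType) (z w : R[i]) :
  complex.Re (z * w) = complex.Re z * complex.Re w - complex.Im z * complex.Im w.
Proof. by case: z; case: w. Qed.

Lemma cImM (R : realType) (z w : R[i]) :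
  complex.Im (z * w) = complex.Re z * complex.Im w + complex.Im z * complex.Re w.
Proof. by case: z; case: w. Qed.

Lemma ReIm_inj (R : realType) (z w : R[i]) :
  complex.Re z = complex.Re w -> complex.Im z = complex.Im w -> z = w.
Proof. by case: z => a b; case: w => c d /= -> ->. Qed.

(** Existence and value are bundled, so the rules below compose without separate derivability
    conditions. *)
Definition has_deriveR (R : realType) (f : R -> R[i]) (x : R) (d : R[i]) : Prop :=
  is_derive x 1 (fun y => complex.Re (f y)) (complex.Re d) /\
  is_derive x 1 (fun y => complex.Im (f y)) (complex.Im d).

Lemma derivableR_has (R : realType) (f : R -> R[i]) x :
  derivableR f x -> has_deriveR f x (deriveR f x).
Proof.
move=> [fr fi]; split; rewrite /deriveR /= derive1E; exact: derivableP.
Qed.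

Lemma has_derivableR (R : realType) (f : R -> R[i]) x d :
  has_deriveR f x d -> derivableR f x.
Proof. by move=> [[? _] [? _]]; split. Qed.

Lemma has_deriveRE (R : realType) (f : R -> R[i]) x d :
  has_deriveR f x d -> deriveR f x = d.
Proof.
by move=> [[_ er] [_ ei]]; apply: ReIm_inj; rewrite /deriveR /= derive1E.
Qed.

Lemma has_deriveR_cst (R : realType) (c : R[i]) x : has_deriveR (fun=> c) x 0.
Proof. by split; exact: is_derive_cst. Qed.

Lemma has_deriveRD (R : realType) (f g : R -> R[i]) x df dg :
  has_deriveR f x df -> has_deriveR g x dg ->
  has_deriveR (fun y => f y + g y) x (df + dg).
Proof.
move=> [fr fi] [gr gi]; split.
- rewrite cReD (_ : (fun y => _) = (fun y => complex.Re (f y)) + (fun y => complex.Re (g y))).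
    exact: is_deriveD.
  by apply: funext => y; rewrite cReD.
- rewrite cImD (_ : (fun y => _) = (fun y => complex.Im (f y)) + (fun y => complex.Im (g y))).
    exact: is_deriveD.
  by apply: funext => y; rewrite cImD.
Qed.

Lemma has_deriveRM (R : realType) (f g : R -> R[i]) x df dg :
  has_deriveR f x df -> has_deriveR g x dg ->
  has_deriveR (fun y => f y * g y) x (df * g x + f x * dg).
Proof.
move=> [fr fi] [gr gi]; split.
- rewrite (_ : (fun y => _) = (fun y => complex.Re (f y)) * (fun y => complex.Re (g y))
     - (fun y => complex.Im (f y)) * (fun y => complex.Im (g y))); last first.
    by apply: funext => y; rewrite cReM.
  apply: is_derive_eq; rewrite cReD !cReM /GRing.scale /=; ring.
- rewrite (_ : (fun y => _) = (fun y => complex.Re (f y)) * (fun y => complex.Im (g y))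
     + (fun y => complex.Im (f y)) * (fun y => complex.Re (g y))); last first.
    by apply: funext => y; rewrite cImM.
  apply: is_derive_eq; rewrite cImD !cImM /GRing.scale /=; ring.
Qed.

Lemma has_deriveR_eq (R : realType) (f : R -> R[i]) x d d' :
  has_deriveR f x d -> d = d' -> has_deriveR f x d'.
Proof. by move=> ? <-. Qed.

Lemma has_deriveRZ (R : realType) (c : R[i]) (f : R -> R[i]) x df :
  has_deriveR f x df -> has_deriveR (fun y => c * f y) x (c * df).
Proof.
move=> fx; apply: has_deriveR_eq (has_deriveRM (has_deriveR_cst c x) fx) _.
by rewrite mul0r add0r.
Qed.

Lemma has_deriveRN (R : realType) (f : R -> R[i]) x df :
  has_deriveR f x df -> has_deriveR (fun y => - f y) x (- df).
Proof.
move=> /(has_deriveRZ (- 1)); rewrite mulN1r.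
by under [X in has_deriveR X]eq_fun do rewrite mulN1r.
Qed.

Lemma has_deriveR_sum (R : realType) (I : Type) (s : seq I) (P : pred I)
    (f : I -> R -> R[i]) x (df : I -> R[i]) :
  (forall i, P i -> has_deriveR (f i) x (df i)) ->
  has_deriveR (fun y => \sum_(i <- s | P i) f i y) x (\sum_(i <- s | P i) df i).
Proof.
move=> fx; elim: s => [|i s IH].
  rewrite big_nil; under [X in has_deriveR X]eq_fun do rewrite big_nil.
  exact: has_deriveR_cst.
rewrite big_cons; under [X in has_deriveR X]eq_fun do rewrite big_cons.
by case: ifP => // Pi; apply: has_deriveRD => //; exact: fx.
Qed.

Lemma has_deriveRV (R : realType) (f : R -> R[i]) x df :
  f x != 0 -> has_deriveR f x df ->
  has_deriveR (fun y => (f y)^-1) x (- (f x ^- 2 * df)).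
Proof.
move=> fx0 [fr fi].
(* [N] is the squared modulus. The inverse is the conjugate divided by [N], so the real product and
   inverse rules apply to each part. *)
pose N y := complex.Re (f y) ^+ 2 + complex.Im (f y) ^+ 2.
have N0 : N x != 0.
  apply: contra_neq fx0 => /eqP; rewrite paddr_eq0 ?sqr_ge0 // !sqrf_eq0.
  by move=> /andP[/eqP ? /eqP ?]; apply: ReIm_inj.
have NE : N = (fun y => complex.Re (f y)) * (fun y => complex.Re (f y))
   + (fun y => complex.Im (f y)) * (fun y => complex.Im (f y)).
  by apply: funext => y; rewrite /N !expr2.
have dN : is_derive x 1 N
    (2 * (complex.Re (f x) * complex.Re df + complex.Im (f x) * complex.Im df)).
  rewrite NE; apply: is_derive_eq; rewrite /GRing.scale /=; ring.
have dNV := is_deriveV N0 dN.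
have VE y : (f y)^-1 = (complex.Re (f y) / N y) +i* (- (complex.Im (f y) / N y)).
  by rewrite /N; case: (f y).
have -> : - (f x ^- 2 * df) = - ((f x)^-1 * (f x)^-1 * df) by rewrite expr2 invfM.
have NxE : N x = complex.Re (f x) ^+ 2 + complex.Im (f x) ^+ 2 by [].
split.
- rewrite (_ : (fun y => _) = (fun y => complex.Re (f y)) * (fun y => (N y)^-1)); last first.
    by apply: funext => y; rewrite VE.
  apply: is_derive_eq; rewrite cReN cReM cReM cImM VE /GRing.scale /=.
  move: N0; rewrite NxE; move: (complex.Re _) (complex.Im _) (complex.Re _) (complex.Im _).
  by move=> *; field.
- rewrite (_ : (fun y => _) = - ((fun y => complex.Im (f y)) * (fun y => (N y)^-1))); last first.
    by apply: funext => y; rewrite VE.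
  apply: is_derive_eq; rewrite cImN cImM cReM cImM VE /GRing.scale /=.
  move: N0; rewrite NxE; move: (complex.Re _) (complex.Im _) (complex.Re _) (complex.Im _).
  by move=> *; field.
Qed.

Definition has_deriveR_mx (R : realType) m n (F : R -> 'M[R[i]]_(m, n)) x
    (dF : 'M[R[i]]_(m, n)) : Prop :=
  forall i j, has_deriveR (fun y => F y i j) x (dF i j).

Lemma derivableR_mx_has (R : realType) m n (F : R -> 'M[R[i]]_(m, n)) x :
  derivableR_mx F x -> has_deriveR_mx F x (deriveR_mx F x).
Proof. by move=> Fx i j; rewrite mxE; exact: derivableR_has. Qed.

Lemma has_deriveR_mxE (R : realType) m n (F : R -> 'M[R[i]]_(m, n)) x dF :
  has_deriveR_mx F x dF -> derivableR_mx F x /\ deriveR_mx F x = dF.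
Proof.
move=> Fx; split=> [i j|]; first exact: has_derivableR (Fx i j).
by apply/matrixP => i j; rewrite mxE; exact: has_deriveRE.
Qed.

Lemma has_deriveR_mx_cst (R : realType) m n (A : 'M[R[i]]_(m, n)) x :
  has_deriveR_mx (fun=> A) x 0.
Proof. by move=> i j; rewrite mxE; exact: has_deriveR_cst. Qed.

Lemma has_deriveR_mx_eq (R : realType) m n (F : R -> 'M[R[i]]_(m, n)) x dF dF' :
  has_deriveR_mx F x dF -> dF = dF' -> has_deriveR_mx F x dF'.
Proof. by move=> ? <-. Qed.

Lemma has_deriveR_mxM (R : realType) m n p (F : R -> 'M[R[i]]_(m, n))
    (G : R -> 'M[R[i]]_(n, p)) x dF dG :
  has_deriveR_mx F x dF -> has_deriveR_mx G x dG ->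
  has_deriveR_mx (fun y => F y *m G y) x (dF *m G x + F x *m dG).
Proof.
move=> Fx Gx i j; under [X in has_deriveR X]eq_fun do rewrite mxE.
apply: has_deriveR_eq (has_deriveR_sum _ _) _ => [k _|]; first exact: has_deriveRM.
by rewrite !mxE -big_split.
Qed.

Lemma has_deriveR_mxD (R : realType) m n (F G : R -> 'M[R[i]]_(m, n)) x dF dG :
  has_deriveR_mx F x dF -> has_deriveR_mx G x dG ->
  has_deriveR_mx (fun y => F y + G y) x (dF + dG).
Proof.
move=> Fx Gx i j; under [X in has_deriveR X]eq_fun do rewrite mxE.
by rewrite mxE; exact: has_deriveRD.
Qed.

Lemma has_deriveR_mxZ (R : realType) m n (f : R -> R[i]) (G : R -> 'M[R[i]]_(m, n)) x df dG :
  has_deriveR f x df -> has_deriveR_mx G x dG ->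
  has_deriveR_mx (fun y => f y *: G y) x (df *: G x + f x *: dG).
Proof.
move=> fx Gx i j; under [X in has_deriveR X]eq_fun do rewrite mxE.
by rewrite !mxE; exact: has_deriveRM.
Qed.

Lemma has_deriveR_mxN (R : realType) m n (F : R -> 'M[R[i]]_(m, n)) x dF :
  has_deriveR_mx F x dF -> has_deriveR_mx (fun y => - F y) x (- dF).
Proof.
move=> Fx i j; under [X in has_deriveR X]eq_fun do rewrite mxE.
by rewrite mxE; exact: has_deriveRN.
Qed.

Lemma has_deriveR_trmx (R : realType) m n (F : R -> 'M[R[i]]_(m, n)) x dF :
  has_deriveR_mx F x dF -> has_deriveR_mx (fun y => (F y)^T) x dF^T.
Proof.
by move=> Fx i j; under [X in has_deriveR X]eq_fun do rewrite mxE; rewrite mxE.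
Qed.

Lemma has_deriveR_mxMl (R : realType) m n p (A : 'M[R[i]]_(m, n))
    (G : R -> 'M[R[i]]_(n, p)) x dG :
  has_deriveR_mx G x dG -> has_deriveR_mx (fun y => A *m G y) x (A *m dG).
Proof.
move=> Gx; apply: has_deriveR_mx_eq (has_deriveR_mxM (has_deriveR_mx_cst A x) Gx) _.
by rewrite mul0mx add0r.
Qed.

Lemma has_deriveR_mxMr (R : realType) m n p (F : R -> 'M[R[i]]_(m, n))
    (A : 'M[R[i]]_(n, p)) x dF :
  has_deriveR_mx F x dF -> has_deriveR_mx (fun y => F y *m A) x (dF *m A).
Proof.
move=> Fx; apply: has_deriveR_mx_eq (has_deriveR_mxM Fx (has_deriveR_mx_cst A x)) _.
by rewrite mulmx0 addr0.
Qed.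

Lemma has_deriveR_mxZl (R : realType) m n (c : R[i]) (F : R -> 'M[R[i]]_(m, n)) x dF :
  has_deriveR_mx F x dF -> has_deriveR_mx (fun y => c *: F y) x (c *: dF).
Proof.
move=> Fx; apply: has_deriveR_mx_eq (has_deriveR_mxZ (has_deriveR_cst c x) Fx) _.
by rewrite scale0r add0r.
Qed.

(** * Norm estimates and mean value inequalities *)

(** A real-valued norm equivalent to the modulus, adapted to treating real and imaginary parts
    separately. *)
Definition norm1 (R : realType) (z : R[i]) : R :=
  `|complex.Re z| + `|complex.Im z|.

Lemma norm1_ge0 (R : realType) (z : R[i]) : 0 <= norm1 z.
Proof. by rewrite addr_ge0. Qed.

Lemma norm10 (R : realType) : norm1 (0 : R[i]) = 0.
Proof. by rewrite /norm1 normr0 addr0. Qed.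

Lemma norm1D (R : realType) (z w : R[i]) : norm1 (z + w) <= norm1 z + norm1 w.
Proof. by rewrite /norm1 cReD cImD addrACA lerD // ler_normD. Qed.

Lemma norm1N (R : realType) (z : R[i]) : norm1 (- z) = norm1 z.
Proof. by rewrite /norm1 cReN cImN !normrN. Qed.

Lemma norm1M (R : realType) (z w : R[i]) : norm1 (z * w) <= norm1 z * norm1 w.
Proof.
rewrite /norm1 cReM cImM.
apply: le_trans (lerD (ler_normB _ _) (ler_normD _ _)) _; rewrite !normrM.
by rewrite le_eqVlt; apply/orP; left; apply/eqP; ring.
Qed.

Lemma norm1MR (R : realType) (h : R) (w : R[i]) : norm1 (h%:C * w) = `|h| * norm1 w.
Proof. by rewrite /norm1 cReM cImM /= !mul0r subr0 addr0 !normrM mulrDr. Qed.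

Lemma norm1_sum (R : realType) (I : finType) (f : I -> R[i]) :
  norm1 (\sum_i f i) <= \sum_i norm1 (f i).
Proof.
elim/big_ind2: _ => [|z a w b za wb|//]; first by rewrite norm10.
by apply: le_trans (norm1D _ _) _; exact: lerD.
Qed.

Definition norm1_mx (R : realType) m n (A : 'M[R[i]]_(m, n)) : R :=
  \sum_i \sum_j norm1 (A i j).

Lemma norm1_mx_ge0 (R : realType) m n (A : 'M[R[i]]_(m, n)) : 0 <= norm1_mx A.
Proof. by do 2![apply: sumr_ge0 => ? _]; exact: norm1_ge0. Qed.

Lemma norm1_mxD (R : realType) m n (A B : 'M[R[i]]_(m, n)) :
  norm1_mx (A + B) <= norm1_mx A + norm1_mx B.
Proof.
rewrite /norm1_mx -big_split; apply: ler_sum => i _; rewrite -big_split.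
by apply: ler_sum => j _; rewrite mxE; exact: norm1D.
Qed.

Lemma norm1_mx_entry (R : realType) m n (A : 'M[R[i]]_(m, n)) i j :
  norm1 (A i j) <= norm1_mx A.
Proof.
rewrite /norm1_mx (bigD1 i) //= (bigD1 j) //= -addrA lerDl addr_ge0 //.
  by apply: sumr_ge0 => ? _; exact: norm1_ge0.
by do 2![apply: sumr_ge0 => ? _]; exact: norm1_ge0.
Qed.

Lemma norm1_mxM (R : realType) m n p (A : 'M[R[i]]_(m, n)) (B : 'M[R[i]]_(n, p)) :
  norm1_mx (A *m B) <= norm1_mx A * norm1_mx B.
Proof.
rewrite /norm1_mx mulr_suml; apply: ler_sum => i _.
apply: (@le_trans _ _ (\sum_j \sum_k norm1 (A i k) * norm1 (B k j))).
  apply: ler_sum => j _; rewrite mxE; apply: le_trans (norm1_sum _) _.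
  by apply: ler_sum => k _; exact: norm1M.
rewrite exchange_big /= mulr_suml; apply: ler_sum => k _.
rewrite -mulr_sumr ler_wpM2l ?norm1_ge0 //.
(* Row k of [B] is bounded by the sum over all rows; this is where submultiplicativity becomes an
   inequality. *)
rewrite [leRHS](bigD1 k) //= lerDl.
by do 2![apply: sumr_ge0 => ? _]; exact: norm1_ge0.
Qed.

(** The symmetric interval around x0 in the hypothesis covers x on either side of x0 with one
    statement. *)
Lemma mean_value_bound (R : realType) (f d : R -> R) (x0 x b : R) :
  (forall y, `|y - x0| <= `|x - x0| -> is_derive y 1 f (d y) /\ `|d y| <= b) ->
  `|f x - f x0| <= b * `|x - x0|.
Proof.
move=> H.
have main (u v : R) : u <= v ->
    (forall y : R, u <= y <= v -> is_derive y 1 f (d y) /\ `|d y| <= b) ->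
    `|f v - f u| <= b * `|v - u|.
  move=> uv H'.
  have [||c cuv ->] := @MVT_segment R f d u v uv.
  - by move=> y /[!in_itv] /= /andP[uy yv]; case: (H' y) => //; rewrite !ltW.
  - apply: derivable_within_continuous => y /[!in_itv] /= yuv.
    by case: (H' y yuv) => -[].
  - rewrite normrM ler_wpM2r //; move: cuv; rewrite in_itv /= => cuv.
    by case: (H' c cuv).
have [xx|xx] := leP x0 x.
  apply: main => // y /andP[y1 y2]; apply: H.
  by rewrite !ger0_norm ?subr_ge0 // lerD2r.
rewrite distrC (distrC x); apply: main; first exact: ltW.
move=> y /andP[y1 y2]; apply: H.
by rewrite distrC (distrC x) !ger0_norm ?subr_ge0 // ?lerD2l ?lerN2 // ltW.
Qed.

(** The two parts of a complex function have no common intermediate point. Each is estimated alone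
    by [b], whence the factor 2. *)
Lemma mean_value_norm1 (R : realType) (f d : R -> R[i]) (x0 x b : R) :
  (forall y, `|y - x0| <= `|x - x0| -> has_deriveR f y (d y) /\ norm1 (d y) <= b) ->
  norm1 (f x - f x0) <= 2 * b * `|x - x0|.
Proof.
move=> H; rewrite /norm1 cReD cImD cReN cImN.
have H1 : `|complex.Re (f x) - complex.Re (f x0)| <= b * `|x - x0|.
  apply: (@mean_value_bound R (fun y => complex.Re (f y)) (fun y => complex.Re (d y))).
  move=> y /H[[fr _] db]; split=> //; apply: le_trans db.
  by rewrite lerDl.
have H2 : `|complex.Im (f x) - complex.Im (f x0)| <= b * `|x - x0|.
  apply: (@mean_value_bound R (fun y => complex.Im (f y)) (fun y => complex.Im (d y))).
  move=> y /H[[_ fi] db]; split=> //; apply: le_trans db.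
  by rewrite lerDr.
lra.
Qed.

(** The factor N comes from summing the scalar estimate over the N entries. *)
Lemma mean_value_norm1_cV (R : realType) N (f d : R -> 'cV[R[i]]_N) (x0 x b : R) :
  (forall y, `|y - x0| <= `|x - x0| ->
    has_deriveR_mx f y (d y) /\ norm1_mx (d y) <= b) ->
  norm1_mx (f x - f x0) <= N%:R * (2 * b * `|x - x0|).
Proof.
move=> H; rewrite /norm1_mx -[N in N%:R]card_ord mulr_natl -sumr_const.
apply: ler_sum => i _; rewrite big_ord1 !mxE.
apply: (@mean_value_norm1 R (fun y => f y i 0) (fun y => d y i 0)).
move=> y /H[fy db]; split; first exact: fy.
by apply: le_trans db; exact: norm1_mx_entry.
Qed.

Lemma is_derive_cvg (R : realType) (f : R -> R) (x d : R) :
  is_derive x 1 f d -> (f y @[y --> x] --> f x)%classic.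
Proof.
by move=> [fx _]; apply: differentiable_continuous; apply/derivable1_diffP.
Qed.

Lemma has_deriveR_continuous (R : realType) (f : R -> R[i]) (x : R) d :
  has_deriveR f x d -> {for x, continuous (fun y => norm1 (f y - f x))} /\
  {for x, continuous (fun y => norm1 (f y))}.
Proof.
move=> [/is_derive_cvg fr /is_derive_cvg fi]; split; rewrite /norm1.
  under [X in {for _, continuous X}]eq_fun do rewrite cReD cImD cReN cImN.
  by apply: cvgD; apply: cvg_norm; apply: cvgB => //; exact: cvg_cst.
by apply: cvgD; apply: cvg_norm.
Qed.

Lemma cvg_sum (R : realType) (I : Type) (s : seq I) (f : I -> R -> R) (x : R) (l : I -> R) :
  (forall i, f i y @[y --> x] --> l i)%classic ->
  (\sum_(i <- s) f i y @[y --> x] --> \sum_(i <- s) l i)%classic.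
Proof.
move=> fl; elim: s => [|i s IH].
  by rewrite big_nil; under eq_fun do rewrite big_nil; exact: cvg_cst.
by rewrite big_cons; under eq_fun do rewrite big_cons; exact: cvgD.
Qed.

Lemma has_deriveR_mx_continuous (R : realType) m n (F : R -> 'M[R[i]]_(m, n)) x dF :
  has_deriveR_mx F x dF -> {for x, continuous (fun y => norm1_mx (F y - F x))} /\
  {for x, continuous (fun y => norm1_mx (F y))}.
Proof.
move=> Fx; split; rewrite /norm1_mx.
  apply: cvg_sum => i; apply: cvg_sum => j.
  have E y : (F y - F x) i j = F y i j - F x i j by rewrite !mxE.
  by rewrite E; under eq_fun do rewrite E; exact: (has_deriveR_continuous (Fx i j)).1.
apply: cvg_sum => i; apply: cvg_sum => j.
exact: (has_deriveR_continuous (Fx i j)).2.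
Qed.

(* At a maximum point of |v| the mean value inequality reads
   max|v| <= |v x0| + max|v| / 2. *)
Lemma linear_ode_bound (R : realType) N (v dv : R -> 'cV[R[i]]_N) (x0 c e : R) :
  0 <= e -> 0 <= c -> N%:R * (2 * c * e) <= 2^-1 ->
  (forall y, `|y - x0| <= e ->
    has_deriveR_mx v y (dv y) /\ norm1_mx (dv y) <= c * norm1_mx (v y)) ->
  forall y, `|y - x0| <= e -> norm1_mx (v y) <= 2 * norm1_mx (v x0).
Proof.
move=> e0 c0 Nce H.
have itvE y : (y \in `[x0 - e, x0 + e]) = (`|y - x0| <= e).
  by rewrite in_itv /= ler_distl.
have [||z] := @EVT_max R (fun y => norm1_mx (v y)) (x0 - e) (x0 + e).
- lra.
- apply: continuous_in_subspaceT => y; rewrite inE /= itvE => ye.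
  exact: (has_deriveR_mx_continuous (H _ ye).1).2.
rewrite itvE => ze zmax y; rewrite -itvE => /zmax ye; apply: le_trans ye _.
have : norm1_mx (v z) <= norm1_mx (v x0) + norm1_mx (v z - v x0).
  by rewrite -{1}(subrK (v x0) (v z)) addrC norm1_mxD.
have : norm1_mx (v z - v x0) <= N%:R * (2 * (c * norm1_mx (v z)) * `|z - x0|).
  apply: mean_value_norm1_cV => y' y'z.
  have y'e := le_trans y'z ze.
  have [? h] := H _ y'e; split=> //; apply: le_trans h _.
  by rewrite ler_wpM2l // zmax // itvE.
have : N%:R * (2 * (c * norm1_mx (v z)) * `|z - x0|) <= 2^-1 * norm1_mx (v z).
  apply: (@le_trans _ _ (N%:R * (2 * c * e) * norm1_mx (v z))).
    have -> : N%:R * (2 * (c * norm1_mx (v z)) * `|z - x0|) =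
        N%:R * (2 * c * `|z - x0|) * norm1_mx (v z) by ring.
    by rewrite ler_wpM2r ?norm1_mx_ge0 // ler_wpM2l // ler_wpM2l // mulr_ge0.
  by rewrite ler_wpM2r // norm1_mx_ge0.
have := norm1_mx_ge0 (v z); lra.
Qed.

(** A criterion without division: an error bound for a whole vector passes directly to the real and
    imaginary parts of its entries. *)
Lemma is_derive_eps (R : realType) (f : R -> R) (x d : R) :
  (forall e, 0 < e -> \forall h \near 0, `|f (x + h) - f x - h * d| <= e * `|h|) ->
  is_derive x 1 f d.
Proof.
move=> H.
have cv : (h^-1 *: ((f \o shift x) (h *: (1 : R)) - f x) @[h --> 0^'] --> d)%classic.
  apply/cvgrPdist_le => e e0.
  have := H e e0; move=> /nbhs_dnbhs {}H.
  near=> h.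
  have h0 : h != 0 by near: h; exact: nbhs_dnbhs_neq.
  rewrite /= /GRing.scale /= mulr1 distrC (addrC h).
  have -> : h^-1 * (f (x + h) - f x) - d = h^-1 * (f (x + h) - f x - h * d) by field.
  rewrite normrM normfV mulrC ler_pdivrMr ?normr_gt0 //.
  by near: h.
by split; [apply/cvg_ex; exists d|exact: cvg_lim cv].
Unshelve. all: by end_near. Qed.

Lemma has_deriveR_eps (R : realType) (f : R -> R[i]) (x : R) (d : R[i]) :
  (forall e, 0 < e ->
     \forall h \near 0, norm1 (f (x + h) - f x - h%:C * d) <= e * `|h|) ->
  has_deriveR f x d.
Proof.
move=> H; split; apply: is_derive_eps => e /H; apply: filterS => h; apply: le_trans.
  by rewrite /norm1 !(cReD, cReN, cReM) /= mul0r subr0 lerDl.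
by rewrite /norm1 !(cImD, cImN, cImM) /= mul0r addr0 lerDr.
Qed.

(** * Complex derivatives and the exponential *)

Lemma norm1_le_normc (R : realType) (z : R[i]) (e : R) :
  `|z| <= e%:C -> norm1 z <= 2 * e.
Proof.
move=> ze; rewrite mulr_natl mulr2n /norm1; apply: lerD; rewrite -lecR.
  exact: le_trans (normc_ge_Re z) ze.
rewrite -normrN -ReiNIm; apply: le_trans (normc_ge_Re _) _.
by rewrite normrM (_ : `|'i%C| = 1) ?mulr1 // normc_def /= expr0n add0r expr1n sqrtr1.
Qed.

Lemma normc_le_norm1 (R : realType) (z : R[i]) : `|z| <= (norm1 z)%:C.
Proof.
rewrite [z in `|z|]complexE; apply: le_trans (ler_normD _ _) _.
rewrite normrM (_ : `|'i%C| = 1) ?mul1r; last first.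
  by rewrite normc_def /= expr0n add0r expr1n sqrtr1.
by rewrite /norm1 rmorphD /= !normc_def /= !expr0n /= !addr0 !sqrtr_sqr.
Qed.

Lemma pos_complexE (R : realType) (e : R[i]) :
  0 < e -> exists2 d : R, 0 < d & e = d%:C.
Proof.
case: e => a b; rewrite ltcE /= => /andP[/eqP -> a0]; exists a => //.
Qed.

Lemma nearC (R : realType) (P : R[i] -> Prop) :
  (\forall h \near (0 : R[i]^o), P h) <->
  exists2 d : R, 0 < d & forall h, norm1 h < d -> P h.
Proof.
split.
  move=> /nbhs_ballP[e /= /pos_complexE[d d0 ->] H]; exists d => // h hd; apply: H.
  by rewrite /ball /= sub0r normrN; apply: le_lt_trans (normc_le_norm1 h) _; rewrite ltcR.
(* Since [norm1] is at most twice the modulus, the ball of radius d / 3 has [norm1] at most 2 d / 3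
   < d. *)
move=> [d d0 H]; apply/nbhs_ballP; exists (d / 3)%:C => /=; first by rewrite ltcR divr_gt0.
move=> h; rewrite /ball /= sub0r normrN => hd; apply: H.
by apply: le_lt_trans (norm1_le_normc (ltW hd)) _; lra.
Qed.

Lemma derivableC_eps (R : realType) (f : R[i] -> R[i]) (z d : R[i]) :
  (forall e : R, 0 < e -> exists2 r : R, 0 < r & forall h, norm1 h < r ->
     norm1 (f (h + z) - f z - h * d) <= e * norm1 h) ->
  derivableC f z.
Proof.
move=> H.
suff cv : (h^-1 *: ((f (h *: (1 : R[i]^o) + z) - f z) : R[i]^o)
    @[h --> (0 : R[i]^o)^'] --> (d : R[i]^o))%classic.
  by apply/cvg_ex; exists d.
apply/cvgrPdist_le => e /pos_complexE[r r0 ->].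
(* The half compensates the factor 2 between [norm1 h] and the modulus of h. *)
have r02 : 0 < r / 2 by lra.
have [s s0 Hs] := H _ r02.
rewrite near_withinE; apply/nearC; exists s => // h hs h0.
rewrite /GRing.scale /= mulr1 distrC.
have -> : h^-1 * (f (h + z) - f z) - d = h^-1 * (f (h + z) - f z - h * d) by field.
rewrite normrM normfV mulrC ler_pdivrMr ?normr_gt0 //.
apply: le_trans (normc_le_norm1 _) _.
apply: (@le_trans _ _ ((r / 2 * norm1 h)%:C)); first by rewrite lecR Hs.
have : norm1 h <= 2 * complex.Re `|h|.
  by apply: norm1_le_normc; rewrite RRe_real // normr_real.
rewrite -(@RRe_real _ `|h|) ?normr_real // -rmorphM /= lecR => nh.
apply: le_trans (_ : r / 2 * (2 * complex.Re `|h|) <= _); first by rewrite ler_pM2l.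
by rewrite mulrA divfK.
Qed.

(** The complex derivative is probed along positive real increments only. As it is known to exist,
    this direction already determines it. *)
Lemma derivableC_approx (R : realType) (f : R[i] -> R[i]) (z : R[i]) (e : R) :
  derivableC f z -> 0 < e -> exists2 r : R, 0 < r & forall h : R, 0 < h < r ->
     norm1 (f (z + h%:C) - f z - h%:C * deriveC f z) <= e * h.
Proof.
move=> fz e0.
have cv : (h^-1 *: ((f (h *: (1 : R[i]^o) + z) - f z) : R[i]^o) @[h --> (0 : R[i]^o)^']
    --> (deriveC f z : R[i]^o))%classic.
  by rewrite /deriveC derive1E; exact: fz.
have e2 : 0 < (e / 2)%:C by rewrite ltcR; lra.
move/cvgrPdist_le : cv => /(_ _ e2); rewrite near_withinE => /nearC[r r0 H].
exists r => // h /andP[h0 hr].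
have nh : norm1 h%:C = h by rewrite /norm1 /= normr0 addr0 gtr0_norm.
have hC0 : h%:C != 0 by rewrite -[0]/(0%:C) (inj_eq (@complexI R)) gt_eqF.
have := H h%:C; rewrite nh => /(_ hr hC0).
rewrite /GRing.scale /= mulr1 distrC => /norm1_le_normc.
rewrite mulrCA divff ?mulr1 // => He.
have -> : f (z + h%:C) - f z - h%:C * deriveC f z =
   h%:C * (h%:C^-1 * (f (h%:C + z) - f z) - deriveC f z).
  by rewrite addrC (addrC z); field.
by rewrite norm1MR gtr0_norm // mulrC ler_pM2r.
Qed.

Lemma is_derive_approx (R : realType) (f : R -> R) (x d e : R) :
  is_derive x 1 f d -> 0 < e -> exists2 r : R, 0 < r & forall h : R, `|h| < r ->
     `|f (h + x) - f x - h * d| <= e * `|h|.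
Proof.
move=> [fx fd] e0.
have cv : (h^-1 *: (f (h *: (1 : R) + x) - f x) @[h --> 0^'] --> d)%classic.
  by rewrite -fd; exact: fx.
move/cvgrPdist_le : cv => /(_ _ e0); rewrite near_withinE => /nbhs_ballP[r /= r0 H].
exists r => // h hr; have [->|h0] := eqVneq h 0.
  by rewrite add0r subrr mul0r subr0 normr0 mulr0.
have := H h; rewrite /ball /= sub0r normrN => /(_ hr h0).
rewrite /GRing.scale /= mulr1 distrC => He.
have -> : f (h + x) - f x - h * d = h * (h^-1 * (f (h + x) - f x) - d) by field.
by rewrite normrM mulrC ler_pM2r // normr_gt0.
Qed.

Lemma cexpD (R : realType) (z w : R[i]) : cexp (z + w) = cexp z * cexp w.
Proof.
case: z w => [a b] [c d]; rewrite /cexp /= expRD cosD sinD.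
by apply: ReIm_inj; rewrite /=; ring.
Qed.

Lemma cexp0 (R : realType) : cexp 0 = 1 :> R[i].
Proof. by rewrite /cexp /= expR0 cos0 sin0 mul1r. Qed.

(** The addition law reduces the claim to cexp h = 1 + h + o(h), which follows from the real
    derivatives of exp, cos and sin at 0. *)
Lemma derivableC_cexp (R : realType) (z : R[i]) : derivableC (@cexp R) z.
Proof.
apply: (@derivableC_eps _ _ _ (cexp z)) => e e0.
have [C C0 CE] : exists2 C : R, 0 < C & norm1 (cexp z) <= C.
  by exists (norm1 (cexp z) + 1); have := norm1_ge0 (cexp z); lra.
(* With real error rate [e1] the errors of both parts add up to at most e1 |a| + 5 e1 |b|, hence the
   6; [C] is the size of the factor [cexp z]. The bound 1 gives exp a <= 2. *)
pose e1 := Num.min 1 (e / (6 * C)).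
have e10 : 0 < e1 by rewrite lt_min ltr01 divr_gt0 // mulr_gt0.
have e11 : e1 <= 1 by rewrite ge_min lexx.
have e1e : C * (6 * e1) <= e.
  have : e1 <= e / (6 * C) by rewrite ge_min lexx orbT.
  by rewrite ler_pdivlMr ?mulr_gt0 //; lra.
have [r1 r10 H1] := is_derive_approx (is_derive_expR (0 : R)) e10.
have [r2 r20 H2] := is_derive_approx (is_derive_cos (0 : R)) e10.
have [r3 r30 H3] := is_derive_approx (is_derive_sin (0 : R)) e10.
(* From |a| < e1 / 2 and e1 <= 1 one gets |exp a - 1| <= e1 |a| + |a| <= e1. *)
exists (Num.min (e1 / 2) (Num.min r1 (Num.min r2 r3))).
  by rewrite !lt_min r10 r20 r30 divr_gt0.
move=> h; rewrite !lt_min; set a := complex.Re h; set b := complex.Im h.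
have -> : norm1 h = `|a| + `|b| by [].
move=> /and4P[he h1 h2 h3].
have a0 := normr_ge0 a; have b0 := normr_ge0 b.
have {}H1 : `|expR a - 1 - a| <= e1 * `|a|.
  by have := H1 a; rewrite addr0 expR0 mulr1; apply; lra.
have {}H2 : `|cos b - 1| <= e1 * `|b|.
  by have := H2 b; rewrite addr0 cos0 sin0 oppr0 mulr0 subr0; apply; lra.
have {}H3 : `|sin b - b| <= e1 * `|b|.
  by have := H3 b; rewrite addr0 sin0 cos0 mulr1 subr0; apply; lra.
have Ea : `|expR a - 1| <= e1.
  rewrite -(subrK a (expR a - 1)); apply: le_trans (ler_normD _ _) _.
  have : e1 * `|a| <= 1 * `|a| by rewrite ler_wpM2r.
  lra.
have Ea2 : `|expR a| <= 2.
  rewrite -(subrK 1 (expR a)); apply: le_trans (ler_normD _ _) _.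
  by rewrite normr1; lra.
rewrite cexpD.
have -> : cexp h * cexp z - cexp z - h * cexp z = cexp z * (cexp h - 1 - h) by ring.
apply: le_trans (norm1M _ _) _.
have : norm1 (cexp h - 1 - h) <= 6 * e1 * (`|a| + `|b|).
  rewrite /norm1 !(cReD, cImD, cReN, cImN) /cexp !(cReM, cImM) /= -/a -/b.
  rewrite !mul0r !(subr0, addr0).
  have -> : expR a * cos b - 1 - a = expR a * (cos b - 1) + (expR a - 1 - a) by ring.
  have -> : expR a * sin b - b = expR a * (sin b - b) + (expR a - 1) * b by ring.
  have P1 : `|expR a * (cos b - 1)| <= 2 * (e1 * `|b|) by rewrite normrM ler_pM.
  have P2 : `|expR a * (sin b - b)| <= 2 * (e1 * `|b|) by rewrite normrM ler_pM.
  have P3 : `|(expR a - 1) * b| <= e1 * `|b| by rewrite normrM ler_pM.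
  have := ler_normD (expR a * (cos b - 1)) (expR a - 1 - a).
  have := ler_normD (expR a * (sin b - b)) ((expR a - 1) * b).
  have : 0 <= e1 * `|a| by rewrite mulr_ge0 // ltW.
  have : 0 <= e1 * `|b| by rewrite mulr_ge0 // ltW.
  lra.
move=> Hn; apply: (@le_trans _ _ (C * (6 * e1 * (`|a| + `|b|)))).
  by rewrite ler_pM ?norm1_ge0.
by rewrite mulrA ler_wpM2r // addr_ge0.
Qed.

(** * Exchanging the two derivatives *)

Lemma norm1_mxZ (R : realType) m n (h : R) (A : 'M[R[i]]_(m, n)) :
  0 <= h -> norm1_mx (h%:C *: A) = h * norm1_mx A.
Proof.
move=> h0; rewrite /norm1_mx mulr_sumr; apply: eq_bigr => i _.
by rewrite mulr_sumr; apply: eq_bigr => j _; rewrite mxE norm1MR ger0_norm.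
Qed.

Lemma norm1_mxN (R : realType) m n (A : 'M[R[i]]_(m, n)) :
  norm1_mx (- A) = norm1_mx A.
Proof. by do 2![apply: eq_bigr => ? _]; rewrite mxE norm1N. Qed.

Lemma norm1_mx0 (R : realType) m n : norm1_mx (0 : 'M[R[i]]_(m, n)) = 0.
Proof. by do 2![apply: big1 => ? _]; rewrite mxE norm10. Qed.

Lemma near_right_mul_le (R : realType) (a b : R) :
  0 <= a -> 0 < b -> (\forall h \near 0^'+, h * a <= b)%classic.
Proof.
move=> a0 b0; near=> h.
have : h <= b / (a + 1).
  (* Adding 1 keeps the denominator positive when [a] is 0. *)
  by near: h; apply: nbhs_right_le; rewrite divr_gt0 // ltr_wpDl.
rewrite ler_pdivlMr ?ltr_wpDl // => hb; apply: le_trans hb.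
rewrite ler_wpM2l ?lerDl // ltW //; near: h; exact: nbhs_right_gt.
Unshelve. all: by end_near. Qed.

Lemma derivableC_mx_approx (R : realType) N (v : R[i] -> 'cV[R[i]]_N) (z : R[i]) (e : R) :
  (forall i, derivableC (fun w => v w i 0) z) -> 0 < e ->
  (\forall h \near 0^'+,
     norm1_mx (v (z + h%:C) - v z - h%:C *: deriveC_mx v z) <= e * h)%classic.
Proof.
move=> vz e0.
(* The error is shared among N entries; the successor keeps the quotient meaningful for N = 0. *)
have eN : 0 < e / N.+1%:R by rewrite divr_gt0 // ltr0n.
have H : (\forall h \near 0^'+, forall i : 'I_N, norm1 (v (z + h%:C) i 0 - v z i 0
     - h%:C * deriveC (fun w => v w i 0) z) <= e / N.+1%:R * h)%classic.
  apply: filter_forall => i.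
  have [r r0 Hr] := derivableC_approx (vz i) eN.
  near=> h; apply: Hr; apply/andP; split; near: h.
    exact: nbhs_right_gt.
  exact: nbhs_right_lt.
near=> h.
have h0 : 0 < h by near: h; exact: nbhs_right_gt.
apply: (@le_trans _ _ (\sum_(i < N) e / N.+1%:R * h)).
  apply: ler_sum => i _; rewrite big_ord1 !mxE.
  by move: (i); near: h.
rewrite sumr_const card_ord -[_ *+ N]mulr_natl mulrA ler_pM2r //.
rewrite mulrA ler_pdivrMr ?ltr0n // mulrC ler_pM2l // ler_nat.
exact: leqnSn.
Unshelve. all: by end_near. Qed.

Lemma sub_scale_mxE (K : pzRingType) m n (A B D : 'M[K]_(m, n)) c i j :
  (A - B - c *: D) i j = A i j - B i j - c * D i j.
Proof. by rewrite !mxE. Qed.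

Lemma has_deriveR_id (R : realType) (x : R) : has_deriveR (fun y : R => y%:C) x 1.
Proof. by split => /=; [exact: is_derive_id|exact: is_derive_cst]. Qed.

(* Interchange of d/dx and d/dl at a parameter value where v is constant in x:
   v(y, l) - w is small uniformly in y near x0, so the x-derivative of the
   difference quotient in l stays close to G(x0) w, and this passes to the
   limit in the mean value inequality. *)
Lemma has_deriveR_deriveC_mx (R : realType) N (v : R -> R[i] -> 'cV[R[i]]_N)
    (G : R -> 'M[R[i]]_N) (z : R[i]) (w : 'cV[R[i]]_N) (x0 r0 : R) dG :
  0 < r0 ->
  (forall h, 0 < h < r0 -> forall x,
    has_deriveR_mx (v ^~ (z + h%:C)) x (h%:C *: (G x *m v x (z + h%:C)))) ->
  (forall x, v x z = w) ->
  (forall x i, derivableC (fun l => v x l i 0) z) ->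
  has_deriveR_mx G x0 dG ->
  has_deriveR_mx (fun x => deriveC_mx (v x) z) x0 (G x0 *m w).
Proof.
move=> r00 dv vz dC dGx.
pose F x := deriveC_mx (v x) z.
pose d := G x0 *m w.
suff main (e : R) : 0 < e -> \forall t \near 0,
    norm1_mx (F (x0 + t) - F x0 - t%:C *: d) <= e * `|t|.
  move=> i j; apply: has_deriveR_eps => e /main; apply: filterS => t; apply: le_trans.
  by rewrite -sub_scale_mxE; exact: norm1_mx_entry.
move=> e0.
(* [M] will bound G near x0. [K] will bound v(y, l): v(x0, l) has norm at most |w| + 1, and the
   linear equation at most doubles it. *)
pose K := 2 * (norm1_mx w + 1); pose M := norm1_mx (G x0) + 1.
have K0 : 0 < K by rewrite mulr_gt0 // ltr_wpDl // norm1_mx_ge0.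
have M0 : 0 < M by rewrite ltr_wpDl // norm1_mx_ge0.
(* [e2] bounds the variation of G. It is small enough that the mean value term costs at most half of
   the allowed error e |t|. *)
pose e2 := Num.min 1 (e / (4 * N.+1%:R * (K + 2 * M))).
have KM0 : 0 < 4 * N.+1%:R * (K + 2 * M).
  by rewrite mulr_gt0 ?mulr_gt0 ?ltr0n // addr_gt0 // mulr_gt0.
have e20 : 0 < e2 by rewrite lt_min ltr01 divr_gt0.
have e21 : e2 <= 1 by rewrite ge_min lexx.
have e2e : N%:R * (2 * (e2 * (K + 2 * M))) <= e / 2.
  have : e2 <= e / (4 * N.+1%:R * (K + 2 * M)) by rewrite ge_min lexx orbT.
  rewrite ler_pdivlMr // => H.
  have : N%:R * (e2 * (K + 2 * M)) <= N.+1%:R * (e2 * (K + 2 * M)).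
    rewrite ler_wpM2r ?ler_nat // mulr_ge0 ?ltW // addr_gt0 // mulr_gt0 //.
  lra.
have [delta delta0 HG] : exists2 delta : R, 0 < delta &
    forall y, `|y - x0| < delta -> norm1_mx (G y - G x0) <= e2.
  have := (has_deriveR_mx_continuous dGx).1.
  rewrite /prop_for /continuous_at subrr norm1_mx0 => /cvgrPdist_le /(_ _ e20).
  move=> /nbhs_ballP[s /= s0 Hs]; exists s => // y ys.
  have := Hs y; rewrite /ball /= distrC => /(_ ys); rewrite sub0r normrN.
  by rewrite ger0_norm // norm1_mx_ge0.
apply/nbhs_ballP; exists delta => //= t; rewrite /ball /= sub0r normrN => td.
have [->|t0] := eqVneq t 0.
  by rewrite addr0 subrr scale0r subr0 norm1_mx0 normr0 mulr0.
have s0 : 0 < `|t| by rewrite normr_gt0.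
have HGs y : `|y - x0| <= `|t| -> norm1_mx (G y - G x0) <= e2 /\ norm1_mx (G y) <= M.
  move=> yt; have H := HG _ (le_lt_trans yt td); split=> //.
  rewrite -(subrK (G x0) (G y)) /M addrC; apply: le_trans (norm1_mxD _ _) _.
  by have := norm1_mx_ge0 (G x0); lra.
(* The other half of the error is split between the difference quotients in l at x0 and at x0 +
   t. *)
pose e1 := e * `|t| / 4.
have e10 : 0 < e1 by rewrite divr_gt0 // mulr_gt0.
(* With t fixed, h is taken small for the two points x0 and x0 + t alone, so pointwise
   differentiability in l is enough. The last three bounds serve, in order, the doubling estimate,
   the distance from v(y, l) to v(x0, l), and the distance from v(x0, l) to w. *)
have [h [h0 hr hF hFt [h1 h2 h3]]] : exists h : R, [/\ 0 < h, h < r0,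
    norm1_mx (v x0 (z + h%:C) - w - h%:C *: F x0) <= Num.min 1 e1 * h,
    norm1_mx (v (x0 + t) (z + h%:C) - w - h%:C *: F (x0 + t)) <= e1 * h &
    [/\ h * (N%:R * (2 * M * `|t|)) <= 2^-1,
    h * (N%:R * (2 * (M * K) * `|t|)) <= e2 &
    h * (1 + norm1_mx (F x0)) <= e2]].
  apply: (@filter_ex _ (0 : R)^'+%classic).
  have e110 : 0 < Num.min 1 e1 by rewrite lt_min ltr01.
  have A1 := derivableC_mx_approx (dC x0) e110.
  have A2 := derivableC_mx_approx (dC (x0 + t)) e10.
  rewrite vz in A1; rewrite vz in A2.
  near=> h; split; [near: h|near: h|near: h; exact: A1|near: h; exact: A2|split; near: h].
  - exact: nbhs_right_gt.
  - exact: nbhs_right_lt.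
  - by apply: near_right_mul_le; rewrite ?invr_gt0 // !mulr_ge0 ?ler0n // ltW.
  - apply: near_right_mul_le => //; do 3![apply: mulr_ge0 => //].
    by apply: mulr_ge0; exact: ltW.
  - by apply: near_right_mul_le => //; rewrite addr_ge0 // norm1_mx_ge0.
have {}dv := dv h; rewrite h0 hr in dv; have {}dv := dv isT.
move: dv hF hFt; set l := z + h%:C => dv hF hFt.
have hF1 : norm1_mx (v x0 l - w - h%:C *: F x0) <= h.
  by apply: le_trans hF _; rewrite ler_piMl ?(ltW h0) // ge_min lexx.
have hFe : norm1_mx (v x0 l - w - h%:C *: F x0) <= e1 * h.
  by apply: le_trans hF _; rewrite ler_wpM2r ?(ltW h0) // ge_min lexx orbT.
have vw : norm1_mx (v x0 l - w) <= e2.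
  rewrite -(subrK (h%:C *: F x0) (v x0 l - w)); apply: le_trans (norm1_mxD _ _) _.
  by rewrite norm1_mxZ ?(ltW h0) //; apply: le_trans h3; rewrite mulrDr mulr1 lerD2r.
have vx0 : norm1_mx (v x0 l) <= norm1_mx w + 1.
  rewrite -(subrK w (v x0 l)) addrC; apply: le_trans (norm1_mxD _ _) _.
  by rewrite lerD2l; exact: le_trans vw e21.
have dvb y : `|y - x0| <= `|t| ->
    norm1_mx (h%:C *: (G y *m v y l)) <= h * M * norm1_mx (v y l).
  move=> /HGs[_ GM]; rewrite norm1_mxZ ?(ltW h0) // -mulrA ler_wpM2l ?(ltW h0) //.
  by apply: le_trans (norm1_mxM _ _) _; rewrite ler_wpM2r // norm1_mx_ge0.
have vK y : `|y - x0| <= `|t| -> norm1_mx (v y l) <= K.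
  move=> yt; apply: (@le_trans _ _ (2 * norm1_mx (v x0 l))); last first.
    by rewrite /K ler_wpM2l.
  apply: (@linear_ode_bound R N (v ^~ l) (fun y => h%:C *: (G y *m v y l))
    x0 (h * M) `|t|) => //.
  - by apply: mulr_ge0; exact: ltW.
  - by apply: le_trans h1; rewrite le_eqVlt; apply/orP; left; apply/eqP; ring.
  - by move=> y' y't; split; [exact: dv|exact: dvb].
have vyw y : `|y - x0| <= `|t| -> norm1_mx (v y l - w) <= 2 * e2.
  move=> yt; rewrite -(subrK (v x0 l) (v y l)) -addrA; apply: le_trans (norm1_mxD _ _) _.
  rewrite mulr_natl mulr2n; apply: lerD => //; apply: le_trans h2.
  apply: (@le_trans _ _ (N%:R * (2 * (h * M * K) * `|y - x0|))).
    apply: (@mean_value_norm1_cV R N (v ^~ l) (fun y => h%:C *: (G y *m v y l))) => y' y'y.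
    have y't := le_trans y'y yt.
    split; [exact: dv|apply: le_trans (dvb _ y't) _].
    by rewrite ler_wpM2l ?vK //; apply: mulr_ge0; exact: ltW.
  have -> : h * (N%:R * (2 * (M * K) * `|t|)) = N%:R * (2 * (h * M * K) * `|t|) by ring.
  rewrite ler_wpM2l // ler_wpM2l //; apply: mulr_ge0 => //.
  by apply: mulr_ge0; [apply: mulr_ge0|]; exact: ltW.
have Gd y : `|y - x0| <= `|t| -> norm1_mx (G y *m v y l - d) <= e2 * (K + 2 * M).
  move=> yt; have [H1 H2] := HGs _ yt.
  have -> : G y *m v y l - d = (G y - G x0) *m v y l + G x0 *m (v y l - w).
    by rewrite mulmxBl mulmxBr /d addrA subrK.
  apply: le_trans (norm1_mxD _ _) _; rewrite mulrDr; apply: lerD.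
    by apply: le_trans (norm1_mxM _ _) _; rewrite ler_pM ?norm1_mx_ge0 ?vK.
  apply: le_trans (norm1_mxM _ _) _.
  have -> : e2 * (2 * M) = M * (2 * e2) by ring.
  by apply: ler_pM; rewrite ?norm1_mx_ge0 ?vyw ?lerDl.
have third : norm1_mx (v (x0 + t) l - v x0 l - (h * t)%:C *: d) <=
    N%:R * (2 * (h * (e2 * (K + 2 * M))) * `|t|).
  (* Subtracting the linear function h y d leaves the derivative h (G v - d), which is small by
     [Gd]. *)
  have := @mean_value_norm1_cV R N (fun y => v y l - (h%:C * y%:C) *: d)
    (fun y => h%:C *: (G y *m v y l - d)) x0 (x0 + t) (h * (e2 * (K + 2 * M))).
  rewrite addrAC subrr add0r => H; apply: le_trans (H _).
    rewrite le_eqVlt; apply/orP; left; apply/eqP; congr norm1_mx.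
    by apply/matrixP => i j; rewrite !mxE !(rmorphM, rmorphD) /=; ring.
  move=> y yt; split; last first.
    by rewrite norm1_mxZ ?(ltW h0) // ler_wpM2l ?(ltW h0) // Gd.
  apply: has_deriveR_mx_eq (has_deriveR_mxD (dv y) (has_deriveR_mxN
    (has_deriveR_mxZ (has_deriveRZ _ (has_deriveR_id y)) (has_deriveR_mx_cst d y)))) _.
  by rewrite scaler0 addr0 mulr1 scalerBr.
have key : h * norm1_mx (F (x0 + t) - F x0 - t%:C *: d) <= h * (e * `|t|).
  rewrite -norm1_mxZ ?(ltW h0) //.
  (* Both derivatives in l are replaced by increments of v from its value at z; that value is w at
     either point, so it cancels. *)
  have -> : h%:C *: (F (x0 + t) - F x0 - t%:C *: d) =
     - (v (x0 + t) l - w - h%:C *: F (x0 + t)) + (v x0 l - w - h%:C *: F x0)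
     + (v (x0 + t) l - v x0 l - (h * t)%:C *: d).
    move: (F (x0 + t)) (F x0) (v (x0 + t) l) (v x0 l) (d) => F1 F0 v1 v0 d0.
    by apply/matrixP => i j; rewrite !mxE rmorphM /=; ring.
  apply: le_trans (norm1_mxD _ _) _; apply: le_trans (lerD (norm1_mxD _ _) third) _.
  rewrite norm1_mxN.
  have H : N%:R * (2 * (h * (e2 * (K + 2 * M))) * `|t|) <= e / 2 * (h * `|t|).
    have -> : N%:R * (2 * (h * (e2 * (K + 2 * M))) * `|t|) =
      N%:R * (2 * (e2 * (K + 2 * M))) * (h * `|t|) by ring.
    by rewrite ler_wpM2r //; apply: mulr_ge0; exact: ltW.
  apply: le_trans (lerD (lerD hFt hFe) H) _.
  by rewrite le_eqVlt; apply/orP; left; apply/eqP; rewrite /e1; field.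
by rewrite ler_pM2l in key.
Unshelve. all: by end_near. Qed.

(** * Fundamental analytic solutions *)

Definition has_deriveC (R : realType) (f : R[i] -> R[i]) (z d : R[i]) : Prop :=
  is_derive (z : R[i]^o) (1 : R[i]^o) (f : R[i]^o -> R[i]^o) (d : R[i]^o).

Lemma derivableC_has (R : realType) (f : R[i] -> R[i]) z :
  derivableC f z -> has_deriveC f z (deriveC f z).
Proof. by move=> fz; rewrite /deriveC derive1E; exact: derivableP. Qed.

Lemma has_derivableC (R : realType) (f : R[i] -> R[i]) z d :
  has_deriveC f z d -> derivableC f z.
Proof. by case. Qed.

Lemma has_deriveCE (R : realType) (f : R[i] -> R[i]) z d :
  has_deriveC f z d -> deriveC f z = d.
Proof. by case=> _ <-; rewrite /deriveC derive1E. Qed.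

Lemma has_deriveC_cst (R : realType) (c z : R[i]) : has_deriveC (fun=> c) z 0.
Proof. exact: is_derive_cst. Qed.

Lemma has_deriveCD (R : realType) (f g : R[i] -> R[i]) z df dg :
  has_deriveC f z df -> has_deriveC g z dg ->
  has_deriveC (fun w => f w + g w) z (df + dg).
Proof. exact: is_deriveD. Qed.

Lemma has_deriveCM (R : realType) (f g : R[i] -> R[i]) z df dg :
  has_deriveC f z df -> has_deriveC g z dg ->
  has_deriveC (fun w => f w * g w) z (f z * dg + g z * df).
Proof. exact: is_deriveM. Qed.

Lemma has_deriveC_sum (R : realType) (I : Type) (s : seq I)
    (f : I -> R[i] -> R[i]) z (df : I -> R[i]) :
  (forall i, has_deriveC (f i) z (df i)) ->
  has_deriveC (fun y => \sum_(i <- s) f i y) z (\sum_(i <- s) df i).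
Proof.
move=> fz; elim: s => [|i s IH].
  rewrite big_nil; under [X in has_deriveC X]eq_fun do rewrite big_nil.
  exact: has_deriveC_cst.
rewrite big_cons; under [X in has_deriveC X]eq_fun do rewrite big_cons.
exact: has_deriveCD.
Qed.

Definition derivableC_mx (R : realType) m n (F : R[i] -> 'M[R[i]]_(m, n)) z :=
  forall i j, derivableC (fun w => F w i j) z.

Lemma derivableC_mxM (R : realType) m n p (F : R[i] -> 'M[R[i]]_(m, n))
    (G : R[i] -> 'M[R[i]]_(n, p)) z :
  derivableC_mx F z -> derivableC_mx G z -> derivableC_mx (fun w => F w *m G w) z.
Proof.
move=> Fz Gz i j; under [X in derivableC X]eq_fun do rewrite mxE.
apply: has_derivableC; apply: has_deriveC_sum => k.
by apply: has_deriveCM; apply: derivableC_has; [exact: Fz|exact: Gz].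
Qed.

Lemma derivableC_mx_cst (R : realType) m n (A : 'M[R[i]]_(m, n)) z :
  derivableC_mx (fun=> A) z.
Proof. by move=> i j; exact: has_derivableC (has_deriveC_cst _ _). Qed.

Lemma deriveC_mxMlr (R : realType) m n p q (A : 'M[R[i]]_(m, n))
    (F : R[i] -> 'M[R[i]]_(n, p)) (B : 'M[R[i]]_(p, q)) z :
  derivableC_mx F z ->
  deriveC_mx (fun w => A *m F w *m B) z = A *m deriveC_mx F z *m B.
Proof.
move=> Fz; apply/matrixP => i j; rewrite [LHS]mxE; apply: has_deriveCE.
under [X in has_deriveC X]eq_fun do rewrite mxE.
rewrite mxE; apply: has_deriveC_sum => k.
have H : has_deriveC (fun w => (A *m F w) i k) z ((A *m deriveC_mx F z) i k).
  under [X in has_deriveC X]eq_fun do rewrite mxE.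
  rewrite mxE; apply: has_deriveC_sum => k'; rewrite [deriveC_mx F z k' k]mxE.
  have := has_deriveCM (has_deriveC_cst (A i k') z) (derivableC_has (Fz k' k)).
  by rewrite mulr0 addr0.
by have := has_deriveCM H (has_deriveC_cst (B k j) z); rewrite mulr0 add0r mulrC.
Qed.

(** The factorization of the FAS of the pair is known on a half-plane only; openness lets its
    derivative be computed from the factors. *)
Lemma derivableC_near (R : realType) (f g : R[i] -> R[i]) z (D : set R[i]) :
  (\forall w \near (z : R[i]^o), D w) -> (forall w, D w -> f w = g w) ->
  derivableC f z -> derivableC g z.
Proof.
by move=> Dz fg; apply: near_eq_derivable; apply: filterS Dz => w /fg.
Qed.

(** Openness in terms of [norm1], which yields directly a radius for the real increments used in the
    exchange of derivatives. *)
Definition open_nearC (R : realType) (D : set R[i]) :=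
  forall z, D z -> exists2 d : R, 0 < d & forall h, norm1 h < d -> D (h + z).

Lemma open_nearCP (R : realType) (D : set R[i]) z :
  open_nearC D -> D z -> \forall w \near (z : R[i]^o), D w.
Proof.
move=> oD /oD H; rewrite (near_shift (0 : R[i]^o)) subr0; exact/nearC.
Qed.

Lemma open_upper_half (R : realType) : open_nearC (@upper_half R).
Proof.
move=> z z0; exists (complex.Im z) => // h; rewrite /upper_half /= cImD.
rewrite /norm1 => hz.
have := ler_norm (- complex.Im h); rewrite normrN.
have := normr_ge0 (complex.Re h); lra.
Qed.

Lemma open_lower_half (R : realType) : open_nearC (@lower_half R).
Proof.
move=> z z0; exists (- complex.Im z); first by rewrite oppr_gt0.
move=> h; rewrite /lower_half /= cImD.
rewrite /norm1 => hz.
have := ler_norm (complex.Im h).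
have := normr_ge0 (complex.Re h); lra.
Qed.

(** Pulling l^P out of the Cartan sum shows each diagonal entry as [cexp] of a monomial in l, ready
    for the chain rule. *)
Lemma t_expE (R : realType) (r P : nat) (fP : R[i]) (I : 'I_r -> R) t l i j :
  t_exp P fP I t l i j =
  cexp (cartan (fun k => - iC R * fP * (I k * t)%:C) i i * l ^+ P) *+ (i == j).
Proof.
rewrite mxE; congr (cexp _ *+ _); rewrite /cartan !summxE mulr_suml.
by apply: eq_bigr => k _; rewrite [LHS]mxE [X in _ = X * _]mxE; ring.
Qed.

Lemma derivableC_mx_t_exp (R : realType) (r P : nat) (fP : R[i]) (I : 'I_r -> R) t l :
  derivableC_mx (t_exp P fP I t) l.
Proof.
move=> i j; pose c := cartan (fun k => - iC R * fP * (I k * t)%:C) i i.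
rewrite (_ : (fun w => _) = fun w => cexp (c * w ^+ P) * (i == j)%:R); last first.
  by apply: funext => w; rewrite t_expE mulr_natr.
have dX : derivable (fun l : R[i]^o => (c * l ^+ P : R[i]^o)) (l : R[i]^o) 1.
  apply: (@has_derivableC _ (fun l => c * l ^+ P)).
  apply: has_deriveCM (has_deriveC_cst _ _) (derivableC_has _).
  exact: (@exprn_derivable _ P (l : R[i]^o) 1).
have dE : derivableC (fun w => cexp (c * w ^+ P)) l.
  apply/derivable1_diffP.
  apply: (@differentiable_comp _ R[i]^o R[i]^o R[i]^o (fun l => c * l ^+ P) (@cexp R)).
    exact/derivable1_diffP.
  by apply/derivable1_diffP; exact: derivableC_cexp.
exact: has_derivableC (has_deriveCM (derivableC_has dE) (has_deriveC_cst _ _)).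
Qed.

(** Cartan elements have opposite entries at i and [rev_ord i], so their exponentials are reciprocal
    there and preserve the antidiagonal form S. *)
Lemma cartan_exp_in_G (R : realType) r (h : 'I_r -> R[i]) : in_G (cartan_exp h).
Proof.
apply/in_GS; apply/matrixP => i j; rewrite !mxE (bigD1 j) //= big1 => [|l lj].
  rewrite addr0 mxE (bigD1 i) //= big1 => [|l li].
    rewrite addr0 !mxE !eqxx !mulr1n SmxE.
    have [->|] := eqVneq j (rev_ord i); last by rewrite mulr0n mulr0 mul0r.
    by rewrite cartan_bar mulr1n mulrAC -cexpD subrr cexp0 mul1r.
  by rewrite mxE eq_sym (negPf li) mulr0n mul0r.
by rewrite [X in _ * X]mxE [X in _ * X]mxE eq_sym (negPf lj) mulr0n mulr0.
Qed.

Lemma iC_neq0 (R : realType) : iC R != 0.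
Proof. by rewrite /iC eq_complex /= oner_eq0 andbF. Qed.

Record regular_solution (R : realType) r (q : R -> 'M[R[i]]_(r + r)) (J : 'M[R[i]]_(r + r))
    (D : set R[i]) (chi : R -> R[i] -> 'M[R[i]]_(r + r)) : Prop := RegularSolution {
  regular_G : forall x l, D l -> in_G (chi x l);
  regular_deriv : forall x l, D l ->
    has_deriveR_mx (chi ^~ l) x ((iC R)^-1 *: - ((q x - l *: J) *m chi x l));
  regular_holo : forall x l, D l -> derivableC_mx (chi x) l }.

(** A right factor independent of x, holomorphic in l and with values in G preserves all three
    properties; at fixed t, [t_exp] is such a factor. *)
Lemma regular_half_FAS (R : realType) r (q : R -> 'M[R[i]]_(r + r)) (J : 'I_r -> R)
    (D : set R[i]) El Er (eta chi : R -> R[i] -> 'M[R[i]]_(r + r))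
    (E : R[i] -> 'M[R[i]]_(r + r)) :
  open_nearC D -> half_FAS q J D El Er eta ->
  (forall x l, D l -> chi x l = eta x l *m E l) ->
  (forall l, in_G (E l)) -> (forall l, derivableC_mx E l) ->
  regular_solution q (real_cartan J) D chi.
Proof.
move=> oD [etaG etaq etaD _ _] chiE EG ED.
have DR l : D l -> (D `|` @real_axis R)%classic l by left.
split.
- by move=> x l Dl; rewrite chiE //; apply: in_G_mul => //; exact/etaG/DR.
- move=> x l Dl; have [dx eqx] := etaq l (DR l Dl) x.
  rewrite (_ : chi ^~ l = fun y => eta y l *m E l); last first.
    by apply: funext => y; rewrite chiE.
  rewrite (chiE x l Dl).
  apply: has_deriveR_mx_eq (has_deriveR_mxMr (E l) (derivableR_mx_has dx)) _.
  have /(canRL (scalerK (iC_neq0 R))) -> : iC R *: deriveR_mx (eta ^~ l) x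
     = - ((q x - l *: real_cartan J) *m eta x l).
    by apply/eqP; rewrite -addr_eq0 eqx.
  by rewrite -scalemxAl mulNmx mulmxA.
- move=> x l Dl i j.
  apply: (@derivableC_near _ (fun w => (eta x w *m E w) i j) _ l D).
  + exact: open_nearCP.
  + by move=> w Dw; rewrite chiE.
  + by apply: derivableC_mxM => // i' j'; exact: etaD.
Qed.

Lemma in_gBZ (R : realType) r (q J : 'M[R[i]]_(r + r)) l :
  in_g q -> in_g J -> in_g (q - l *: J).
Proof.
rewrite /in_g => hq hJ.
have -> : (q - l *: J)^T = q^T - l *: J^T by apply/matrixP => i j; rewrite !mxE.
rewrite mulmxBr mulmxBl -scalemxAr -scalemxAl.
move: hq hJ => /eqP; rewrite addrC addr_eq0 => /eqP -> /eqP.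
by rewrite addrC addr_eq0 => /eqP ->; rewrite scalerN opprK addrACA subrr addNr addr0.
Qed.

Lemma invmx_G (R : realType) r (g : 'M[R[i]]_(r + r)) :
  in_G g -> invmx g = @Smx R r *m g^T *m (- @Smx R r).
Proof. by case=> _ ->; rewrite Smx_inv. Qed.

Lemma in_g_trS (R : realType) r (X : 'M[R[i]]_(r + r)) :
  in_g X -> X^T *m @Smx R r = - (@Smx R r *m X).
Proof.
move=> /in_g_tr E.
have -> : X^T *m @Smx R r = - (@Smx R r *m (@Smx R r *m X^T) *m @Smx R r).
  by rewrite !mulmxA Smx_sqr !mulNmx mul1mx opprK.
by rewrite E -!mulmxA Smx_sqr !(mulmxN, mulNmx, mulmx1, opprK).
Qed.

(** In G the inverse is S chi^T S^-1, hence linear in chi: it is differentiated entrywise, and X^T S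
    = - S X puts the transposed equation into dual form. *)
Lemma has_deriveR_invmx (R : realType) r (q : R -> 'M[R[i]]_(r + r)) J
    (D : set R[i]) (chi : R -> R[i] -> 'M[R[i]]_(r + r)) x l :
  (forall y, in_g (q y)) -> in_g J -> regular_solution q J D chi -> D l ->
  has_deriveR_mx (fun y => invmx (chi y l)) x
    ((iC R)^-1 *: (invmx (chi x l) *m (q x - l *: J))).
Proof.
move=> qg Jg chiP Dl.
rewrite (_ : (fun y => _) = fun y => @Smx R r *m (chi y l)^T *m (- @Smx R r)); last first.
  by apply: funext => y; rewrite invmx_G //; exact: regular_G chiP _ _ Dl.
have := has_deriveR_mxMr (- @Smx R r) (has_deriveR_mxMl (@Smx R r)
  (has_deriveR_trmx (regular_deriv chiP x Dl))).
move/has_deriveR_mx_eq; apply.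
rewrite (invmx_G (regular_G chiP x Dl)).
have -> : ((iC R)^-1 *: - ((q x - l *: J) *m chi x l))^T =
    (iC R)^-1 *: - ((chi x l)^T *m (q x - l *: J)^T).
  by rewrite -trmx_mul; apply/matrixP => i j; rewrite !mxE.
rewrite -scalemxAr -scalemxAl; congr (_ *: _).
rewrite !mulmxN !mulNmx opprK -!mulmxA.
by rewrite (in_g_trS (in_gBZ l (qg x) Jg)) !mulmxN.
Qed.

(** Applies the exchange to v(y, l) = chi(y, z)^-1 chi(y, l) w. At l = z + h the coefficients q - z
    J and q - l J differ by h J, which supplies the factor h demanded there. *)
Lemma has_deriveR_log_derivative (R : realType) r (q : R -> 'M[R[i]]_(r + r)) J
    (D : set R[i]) (chi : R -> R[i] -> 'M[R[i]]_(r + r)) x z (w : 'cV[R[i]]_(r + r)) :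
  (forall y, in_g (q y)) -> in_g J -> regular_solution q J D chi ->
  open_nearC D -> D z ->
  has_deriveR_mx (fun y => invmx (chi y z) *m deriveC_mx (chi y) z *m w) x
    ((iC R)^-1 *: (invmx (chi x z) *m J *m chi x z *m w)).
Proof.
move=> qg Jg chiP oD Dz.
have [r0 r00 Hr] := oD z Dz.
pose v y l := invmx (chi y z) *m chi y l *m w.
pose G y := (iC R)^-1 *: (invmx (chi y z) *m J *m chi y z).
rewrite (_ : (fun y => _) = fun y => deriveC_mx (v y) z); last first.
  by apply: funext => y; rewrite deriveC_mxMlr //; exact: regular_holo chiP _ _ Dz.
rewrite scalemxAl.
have dI y := has_deriveR_invmx y qg Jg chiP Dz.
have unitz y : chi y z \in unitmx by case: (regular_G chiP y Dz).
apply: (@has_deriveR_deriveC_mx R (r + r) v G z w x r0 _ r00).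
- move=> h /andP[h0 hr] y.
  have Dh : D (z + h%:C).
    by rewrite addrC; apply: Hr; rewrite /norm1 /= normr0 addr0 gtr0_norm.
  have := has_deriveR_mxMr w (has_deriveR_mxM (dI y) (regular_deriv chiP y Dh)).
  move/has_deriveR_mx_eq; apply.
  rewrite /G /v -!scalemxAl -scalemxAr scalerA [h%:C * _]mulrC -scalerA -scalerDr -scalemxAl.
  congr (_ *: _).
  rewrite !mulmxA -(mulmxA _ (chi y z)) mulmxV // mulmx1 [RHS]scalemxAl.
  congr (_ *m w); rewrite -!mulmxA.
  rewrite mulmxN -mulmxBr -mulmxBl (_ : q y - z *: J - _ = h%:C *: J).
    by rewrite -scalemxAl -scalemxAr.
  by apply/matrixP => a b; rewrite !mxE; ring.
- by move=> y; rewrite /v mulVmx // mul1mx.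
- move=> y i; apply: derivableC_mxM; last exact: derivableC_mx_cst.
  apply: derivableC_mxM; first exact: derivableC_mx_cst.
  exact: regular_holo chiP _ _ Dz.
- apply: has_deriveR_mxZl; apply: has_deriveR_mxM; last exact: regular_deriv chiP _ _ Dz.
  exact: has_deriveR_mxMr (dI x).
Qed.

(** * Symplectic pairings and the dressing theorem *)

(** A 1 x 1 matrix is its own transpose, while skewness of S makes that transpose the negative;
    characteristic zero concludes. *)
Lemma skew_form_eq0 (K : numDomainType) N (S : 'M[K]_N) (w : 'rV[K]_N) :
  S^T = - S -> w *m (S *m w^T) = 0.
Proof.
move=> ST.
have : (w *m (S *m w^T))^T = - (w *m (S *m w^T)).
  by rewrite trmx_mul trmx_mul trmxK ST mulmxN mulNmx mulmxA.
move: (_ *m _) => a /matrixP/(_ 0 0).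
rewrite !mxE => /eqP; rewrite -addr_eq0 -mulr2n mulrn_eq0 /= => /eqP a0.
by apply/matrixP => i j; rewrite !ord1 a0 mxE.
Qed.

(** This gives S m = chi^- S m_0: k is chi^- applied to a constant vector, and A differentiates to a
    pairing with k. *)
Lemma mulmx_G_S (R : realType) r (g : 'M[R[i]]_(r + r)) :
  in_G g -> g *m @Smx R r = @Smx R r *m (invmx g)^T.
Proof.
move=> gG; have gu : g^T \in unitmx by rewrite unitmx_tr; case: gG.
by rewrite trmx_inv -[in RHS](iffLR (in_GS g) gG) mulmxK.
Qed.

(** The row counterpart, which identifies n_0^T S (chi^+)^-1 with n^T S = - p in the definition of
    B. *)
Lemma mulmx_S_invG (R : realType) r (g : 'M[R[i]]_(r + r)) :
  in_G g -> @Smx R r *m invmx g = g^T *m @Smx R r.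
Proof.
by move=> /invmx_G ->; rewrite !mulmxA Smx_sqr mulmxN !mulNmx mul1mx opprK.
Qed.

Lemma tr_mx11 (K : pzRingType) (a : 'M[K]_1) : a^T = a.
Proof. by rewrite [a]mx11_scalar tr_scalar_mx. Qed.

(** J is skew for the symplectic form, so moving it to the other side costs a sign that is absent
    from p k = m^T n. *)
Lemma pairing_transfer (K : comPzRingType) N (S J : 'M[K]_N) (n : 'cV[K]_N)
    (m : 'rV[K]_N) :
  S *m S = - 1%:M -> J^T *m S = - (S *m J) ->
  n^T *m (- S) *m J *m (S *m m^T) = - (m *m J *m n).
Proof.
move=> SS JS; rewrite -(tr_mx11 (m *m J *m n)) !trmx_mul mulmxN !mulNmx.
rewrite -(mulmxA _ S J) -[S *m J]opprK -JS mulmxN mulNmx opprK -!mulmxA.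
by rewrite (mulmxA S S) SS mulNmx mul1mx !mulmxN.
Qed.

(** Between a solution at [a] and a dual solution at [b] the potential cancels; only (a - b) J
    survives. *)
Lemma pairing_deriv (K : comPzRingType) N (q J : 'M[K]_N) (n dn : 'cV[K]_N)
    (m dm : 'rV[K]_N) (I a b : K) :
  I *: dn = - ((q - a *: J) *m n) -> I *: dm = m *m (q - b *: J) ->
  I * (dm *m n + m *m dn) 0 0 = - (b - a) * (m *m J *m n) 0 0.
Proof.
move=> hn hm; have : I *: (dm *m n + m *m dn) = - (b - a) *: (m *m J *m n).
  rewrite scalerDr scalemxAl hm scalemxAr hn mulmxN -mulmxA -mulmxBr -mulmxBl.
  have -> : q - b *: J - (q - a *: J) = - (b - a) *: J.
    by apply/matrixP => i j; rewrite !mxE; ring.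
  by rewrite -scalemxAl -scalemxAr mulmxA.
by move/matrixP/(_ 0 0); rewrite [LHS]mxE [RHS]mxE.
Qed.

Theorem proposition2 (R : realType) (r : nat) (hr : (1 <= r)%N)
  (q0 : R -> R -> 'M[R[i]]_(r + r)) (Jr Ir : 'I_r -> R)
  (P : nat) (Vk : 'I_P -> R -> R -> 'M[R[i]]_(r + r)) (fP : R[i])
  (hLax : lax_pair q0 Jr Ir Vk fP)
  (chip chim : R -> R -> R[i] -> 'M[R[i]]_(r + r))
  (hFAS : FAS_pair q0 Jr Ir Vk fP chip chim)
  (lp lm : R[i]) (hlp : 0 < complex.Im lp) (hlm : complex.Im lm < 0)
  (n0 m0 : 'cV[R[i]]_(r + r)) :
  let S := @Smx R r in
  let J := real_cartan Jr in
  let n := fun x t => chip x t lp *m n0 in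
  let mT := fun x t => m0^T *m invmx (chim x t lm) in
  let m := fun x t => (mT x t)^T in
  let rho := fun x t => (mT x t *m n x t) 0 0 in
  let chip_dot := fun x t => deriveC_mx (fun l => chip x t l) lp in
  let chim_dot := fun x t => deriveC_mx (fun l => chim x t l) lm in
  let A := fun x t =>
    - (lm - lp) *
      (m0^T *m invmx (chim x t lm) *m chim_dot x t *m S *m m0) 0 0 in
  let B := fun x t =>
    (lm - lp) *
      (n0^T *m S *m invmx (chip x t lp) *m chip_dot x t *m n0) 0 0 in
  let Delta := fun x t => rho x t ^+ 2 + A x t * B x t in
  let pi1 := fun x t =>
    (Delta x t)^-1 *:
      ((rho x t *: n x t + B x t *: (S *m m x t)) *m mT x t) in
  let pim1 := fun x t =>
    (Delta x t)^-1 *: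
      (S *m (rho x t *: m x t + A x t *: (S *m n x t)) *m (n x t)^T *m invmx S) in
  let q1 := fun x t =>
    q0 x t + (lm - lp) *: comm_mxC J (pi1 x t - pim1 x t) in
  let c1 := fun l : R[i] => (l - lp) / (l - lm) in
  let u := fun x t l =>
    1%:M + (c1 l - 1) *: pi1 x t + ((c1 l)^-1 - 1) *: pim1 x t in
  forall (l : R[i]) (x t : R),
    l != lp -> l != lm -> Delta x t != 0 ->
    dressing_at J q0 q1 u x t l.
Proof.
move=> S J n mT m rho chip_dot chim_dot A B Delta pi1 pim1 q1 c1 u l x t llp llm D0.
have [etap [etam [FAS chipE chimE _ _]]] := hFAS.
have [phi [psi [T [Sp [Sm [Tp [Tm [Dp [Dm [_ _ _ _ [hp hm]]]]]]]]]]] := FAS t.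
have EG y : in_G (t_exp P fP Ir t y) by exact: cartan_exp_in_G.
have cp : regular_solution (q0 ^~ t) J (@upper_half R) (fun y z => chip y t z).
  apply: (regular_half_FAS (@open_upper_half R) hp _ EG (@derivableC_mx_t_exp R r P fP Ir t)).
  by move=> y z yz; rewrite chipE //; left.
have cm : regular_solution (q0 ^~ t) J (@lower_half R) (fun y z => chim y t z).
  apply: (regular_half_FAS (@open_lower_half R) hm _ EG (@derivableC_mx_t_exp R r P fP Ir t)).
  by move=> y z yz; rewrite chimE //; left.
have qg y : in_g (q0 y t) by case: hLax => _ /(_ y t)/root_span_in_g.
have Jg : in_g J by exact: cartan_in_g.
have SS : S *m S = - 1%:M by exact: Smx_sqr.
have ST : S^T = - S by exact: Smx_tr.
have SV : invmx S = - S by exact: Smx_inv.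
pose q := q0 x t.
pose k y := S *m m y t.
pose p y := (n y t)^T *m (- S).
pose dn := (iC R)^-1 *: - ((q - lp *: J) *m n x t).
pose dm := (iC R)^-1 *: (mT x t *m (q - lm *: J)).
have hn : has_deriveR_mx (n ^~ t) x dn.
  apply: has_deriveR_mx_eq (has_deriveR_mxMr n0 (regular_deriv cp x hlp)) _.
  by rewrite /dn -scalemxAl mulNmx mulmxA.
have hmT : has_deriveR_mx (mT ^~ t) x dm.
  apply: has_deriveR_mx_eq (has_deriveR_mxMl m0^T (has_deriveR_invmx x qg Jg cm hlm)) _.
  by rewrite /dm -scalemxAr mulmxA.
have hk : has_deriveR_mx k x (S *m dm^T).
  by apply: has_deriveR_mxMl; exact: has_deriveR_trmx.
have hpd : has_deriveR_mx p x (dn^T *m (- S)).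
  by apply: has_deriveR_mxMr; exact: has_deriveR_trmx.
pose drho := (dm *m n x t + mT x t *m dn) 0 0.
have hrho : has_deriveR (rho ^~ t) x drho.
  exact: (has_deriveR_mxM hmT hn).
pose dA := - (lm - lp) * ((iC R)^-1 * (mT x t *m J *m k x) 0 0).
have hA : has_deriveR (A ^~ t) x dA.
  rewrite (_ : A ^~ t = fun y => - (lm - lp) * (m0^T *m (invmx (chim y t lm) *m
      deriveC_mx (fun l => chim y t l) lm *m (S *m m0))) 0 0); last first.
    by apply: funext => y; rewrite /A /chim_dot !mulmxA.
  apply: has_deriveRZ.
  apply: has_deriveR_eq (has_deriveR_mxMl m0^T (has_deriveR_log_derivative x (S *m m0)
    qg Jg cm (@open_lower_half R) hlm) 0 0) _.
  have -> : k x = chim x t lm *m (S *m m0).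
    by rewrite mulmxA (mulmx_G_S (regular_G cm x hlm)) /k /m trmx_mul trmxK mulmxA.
  by rewrite -scalemxAr mxE !mulmxA.
(* [B] carries the factor lm - lp, yet the sign here is negative because its row n_0^T S (chi^+)^-1
   is - p. *)
pose dB := - (lm - lp) * ((iC R)^-1 * (p x *m J *m n x t) 0 0).
have hB : has_deriveR (B ^~ t) x dB.
  rewrite (_ : B ^~ t = fun y => (lm - lp) * (n0^T *m S *m (invmx (chip y t lp) *m
      deriveC_mx (fun l => chip y t l) lp *m n0)) 0 0); last first.
    by apply: funext => y; rewrite /B /chip_dot !mulmxA.
  apply: has_deriveR_eq (has_deriveRZ (lm - lp) (has_deriveR_mxMl (n0^T *m S)
    (has_deriveR_log_derivative x n0 qg Jg cp (@open_upper_half R) hlp) 0 0)) _.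
  have pE : p x = - (n0^T *m S *m invmx (chip x t lp)).
    by rewrite -(mulmxA _ S) (mulmx_S_invG (regular_G cp x hlp)) /p /n trmx_mul mulmxN mulmxA.
  by rewrite /dB pE !mulNmx -scalemxAr mxE [X in - _ * (_ * X)]mxE !mulmxA; ring.
pose dDV := - (Delta x t ^- 2 * (2 * rho x t * drho + (dA * B x t + A x t * dB))).
have hDV : has_deriveR (fun y => (Delta y t)^-1) x dDV.
  apply: has_deriveRV => //; rewrite /Delta.
  under [X in has_deriveR X]eq_fun do rewrite expr2.
  apply: has_deriveR_eq (has_deriveRD (has_deriveRM hrho hrho) (has_deriveRM hA hB)) _.
  by ring.
(* S S = - 1 turns A S (S n) into - A n, which is the source of the minus sign in the algebraic
   lemmas. *)
have pim1E y : pim1 y t = (Delta y t)^-1 *: ((rho y t *: k y - A y t *: n y t) *m p y).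
  rewrite /pim1 -/S SV -mulmxA mulmxDr -!scalemxAr (mulmxA S S) SS mulNmx mul1mx scalerN.
  by [].
have hpi1 := has_deriveR_mxZ hDV (has_deriveR_mxM
  (has_deriveR_mxD (has_deriveR_mxZ hrho hn) (has_deriveR_mxZ hB hk)) hmT).
have hpim1 := has_deriveR_mxZ hDV (has_deriveR_mxM (has_deriveR_mxD (has_deriveR_mxZ hrho hk)
  (has_deriveR_mxN (has_deriveR_mxZ hA hn))) hpd).
have hu := has_deriveR_mxD (has_deriveR_mxD (has_deriveR_mx_cst 1%:M x)
  (has_deriveR_mxZl (c1 l - 1) hpi1)) (has_deriveR_mxZl ((c1 l)^-1 - 1) hpim1).
have uE : (fun y => u y t l) = fun y => 1%:M + (c1 l - 1) *: pi1 y t +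
    ((c1 l)^-1 - 1) *: ((Delta y t)^-1 *: ((rho y t *: k y - A y t *: n y t) *m p y)).
  by apply: funext => y; rewrite /u pim1E.
move: hu; rewrite -[X in has_deriveR_mx X]uE => /has_deriveR_mxE[du uDE].
have mk : mT x t *m k x = 0 by exact: skew_form_eq0.
have pn : p x *m n x t = 0.
  by rewrite /p mulmxN mulNmx -mulmxA -{2}(trmxK (n x t)) skew_form_eq0 ?oppr0.
have mn : mT x t *m n x t = (rho x t)%:M by exact: mx11_scalar.
have pk : p x *m k x = (rho x t)%:M.
  rewrite /p /k mulmxN mulNmx -!mulmxA (mulmxA S S) SS mulNmx mul1mx mulmxN opprK.
  by rewrite /m -trmx_mul mn tr_scalar_mx.
have pJk : p x *m J *m k x = - (mT x t *m J *m n x t).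
  exact: (pairing_transfer (n x t) (mT x t) SS (in_g_trS Jg)).
have I0 := iC_neq0 R.
have IV n1 n2 (V : 'M[R[i]]_(n1, n2)) : iC R *: ((iC R)^-1 *: V) = V.
  by rewrite scalerA (divff I0) scale1r.
have Xg z : in_g (q - z *: J) by exact: in_gBZ z (qg x) Jg.
have hdk : iC R *: (S *m dm^T) = - ((q - lm *: J) *m k x).
  have -> : dm^T = (iC R)^-1 *: ((q - lm *: J)^T *m m x t).
    by rewrite /m -trmx_mul; apply/matrixP => i j; rewrite !mxE.
  by rewrite -scalemxAr IV mulmxA (in_g_tr (Xg lm)) !mulNmx mulmxA.
have hdp : iC R *: (dn^T *m - S) = p x *m (q - lp *: J).
  have -> : dn^T = (iC R)^-1 *: - ((n x t)^T *m (q - lp *: J)^T).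
    by rewrite -trmx_mul; apply/matrixP => i j; rewrite !mxE.
  rewrite -scalemxAl IV mulNmx mulmxN opprK -mulmxA (in_g_trS (Xg lp)).
  by rewrite /p !mulmxN mulNmx mulmxA.
have hIdn : iC R *: dn = - ((q - lp *: J) *m n x t) := IV _ _ _.
have hIdm : iC R *: dm = mT x t *m (q - lm *: J) := IV _ _ _.
have hIrho : iC R * drho = - (lm - lp) * (mT x t *m J *m n x t) 0 0 :=
  pairing_deriv hIdn hIdm.
split; [|exact: du|].
- apply/in_GP; rewrite /u pim1E.
  have c10 : c1 l != 0 by apply: mulf_neq0; rewrite ?invr_eq0 subr_eq0.
  exact: (mul_dressing_factor ST SS c10 D0 mk pn mn pk).
- rewrite uDE add0r /u /q1 pim1E.
  have hIA : iC R * dA = - (lm - lp) * (mT x t *m J *m k x) 0 0.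
    by rewrite /dA mulrCA (mulVKf I0).
  have hIB : iC R * dB = - (lm - lp) * (p x *m J *m n x t) 0 0.
    by rewrite /dB mulrCA (mulVKf I0).
  exact: (dressing_equation I0 llp llm D0 mk pn mn pk hIdn hdk hIdm hdp hIrho hIA hIB pJk).
Qed.
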